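(* Let $d\geq 3$ and let $G$ be a $d$-angulation whose external face is incident to $d$ distinct vertices $u_1,\dots,u_d$ (in clockwise order around the external face). Then the set of Schnyder decompositions of $G$, the set of clockwise labellings of $G$, and the set of $d/(d-2)$-orientations of $G$ are in bijection with one another.
   Context: Graphs are finite, loopless, possibly with multiple edges. A plane graph is a connected planar graph with a fixed crossing-free drawing in the plane; the unbounded face is external; vertices/edges incident to it are external, others internal. An edge $e=\{u,v\}$ has two arcs $(u,e)$ (origin $u$) and $(v,e)$. A corner is a pair of consecutive edges around a vertex; it is incident to that vertex and to the face containing it; the degree of a face is its number of corners. A $d$-angulation is a plane graph all of whose faces have degree $d$. Convention on clockwise order: around an internal face one walks along its contour with the face on the right; around the external face one walks along its contour with the external face on the left. $[d]$ denotes $\{1,\dots,d\}$ with addition and subtraction taken modulo $d$. A $k$-fractional orientation of a set of edges assigns to every arc of these edges a value in $\{0,\dots,k\}$, the two arcs of each edge having values summing to $k$; the outdegree of a vertex is the sum of the values of arcs with that origin. A $d/(d-2)$-orientation of $G$ is a $(d-2)$-fractional orientation of the internal edges of $G$ such that each internal vertex has outdegree $d$ and each external vertex has outdegree $0$. A Schnyder decomposition of $G$ is a covering of the internal edges of $G$ by $d$ oriented forests $F_1,\dots,F_d$ (forest $F_i$ has color $i$) such that: (i) each internal edge belongs to exactly $d-2$ of the forests; (ii) for each $i\in[d]$, $F_i$ spans all vertices except $u_i,u_{i+1}$, and consists of $d-2$ trees, each containing exactly one of the vertices $u_j$, $j\neq i,i+1$, and oriented toward that $u_j$; (iii) around each internal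 vertex $v$, the outgoing arcs of colors $1,\dots,d$ appear in clockwise order (several may lie on the same edge), and, calling $e_i$ the edge carrying the outgoing arc of color $i$, all incoming arcs of color $i$ at $v$ lie strictly between $e_{i+1}$ and $e_{i-1}$ in clockwise order around $v$. A clockwise labelling of $G$ is an assignment of a color in $[d]$ to each corner such that: (i) the colors $1,2,\dots,d$ appear in clockwise order around each face (consecutive corners in clockwise order around a face have colors $c$ and $c+1$ modulo $d$); (ii) for each $i\in[d]$, all corners incident to $u_i$ have color $i$; (iii) in clockwise order around each internal vertex, exactly one corner has a larger color (as an integer in $\{1,\dots,d\}$) than the next corner. *)

(* Defs.v *)
From mathcomp Require Import all_boot.

Set Implicit Arguments.
Unset Strict Implicit.
Unset Printing Implicit Defensive.

(* A plane graph is encoded by its rotation system.  A dart is an arc (u, e):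
   [origin x] is u, [opp x] is the other arc of e, and [cw x] is the arc
   following x in clockwise order around u.  [rface x] is the face on the right
   of x, travelling from [origin x] to [origin (opp x)]; the next arc on the
   contour of that face, walked with the face on the right, is
   [finv cw (opp x)].  Planarity is Euler's relation for a connected map. *)
Record plane_graph := PlaneGraph {
  dart : finType;
  vertex : finType;
  face : finType;
  opp : dart -> dart;
  cw : dart -> dart;
  origin : dart -> vertex;
  rface : dart -> face;
  ext_face : face;
  oppK : involutive opp;
  loopless : forall x, origin (opp x) != origin x;
  cw_inj : injective cw;
  originP : forall x y, (origin x == origin y) = fconnect cw x y;
  origin_surj : forall v, exists x, origin x = v;
  rfaceP : forall x y,
    (rface x == rface y) = fconnect (fun z => finv cw (opp z)) x y;
  rface_surj : forall f, exists x, rface x = f;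
  connected : forall v w,
    connect [rel a b | [exists x, (origin x == a) && (origin (opp x) == b)]]
      v w;
  euler : #|vertex| + #|face| = #|[set [set x; opp x] | x : dart]| + 2
}.

Arguments opp {p} x : rename.
Arguments cw {p} x : rename.
Arguments origin {p} x : rename.
Arguments rface {p} x : rename.

Definition target (G : plane_graph) (x : dart G) : vertex G := origin (opp x).

Definition edge (G : plane_graph) (x : dart G) : {set dart G} := [set x; opp x].

(* The corner between x and [cw x] is encoded by x: it is incident to
   [origin x] and lies in [rface x].  Hence the corners of a face f are the
   darts x with [rface x = f]. *)
Definition face_degree (G : plane_graph) (f : face G) : nat :=
  #|[set x : dart G | rface x == f]|.

Definition d_angulation (d : nat) (G : plane_graph) : Prop :=
  forall f : face G, face_degree f = d.

(* Next corner of [rface x] along its contour, with the face on the right. *)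
Definition next_corner (G : plane_graph) (x : dart G) : dart G :=
  finv cw (opp x).

Definition ext_vertex (G : plane_graph) (v : vertex G) : bool :=
  [exists x : dart G, (origin x == v) && (rface x == ext_face G)].

Definition inner_vertex (G : plane_graph) (v : vertex G) : bool :=
  ~~ ext_vertex v.

(* The edge carrying x is internal. *)
Definition inner_dart (G : plane_graph) (x : dart G) : bool :=
  (rface x != ext_face G) && (rface (opp x) != ext_face G).

(* Throughout, colors and the indices of the external vertices are shifted from
   {1, ..., d} to 'I_d = {0, ..., d - 1}; [ordS] and [ord_pred] are +1 and -1
   modulo d. *)

(* The vertices u 0, ..., u (d - 1) are distinct and are met in this cyclic
   order when walking around the external face with this face on the left. *)
Definition external_contour (d : nat) (G : plane_graph) (u : 'I_d -> vertex G) :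
    Prop :=
  injective u /\
  forall i, exists x : dart G,
    [/\ rface (opp x) = ext_face G, origin x = u i & target x = u (ordS i)].

Definition fractional_orientation (G : plane_graph) (S : pred (dart G))
    (k : nat) (o : {ffun {x : dart G | S x} -> 'I_k.+1}) : Prop :=
  forall a b : {x : dart G | S x}, val b = opp (val a) -> o a + o b = k.

Definition outdegree (G : plane_graph) (S : pred (dart G)) (k : nat)
    (o : {ffun {x : dart G | S x} -> 'I_k.+1}) (v : vertex G) : nat :=
  \sum_(a : {x : dart G | S x} | origin (val a) == v) o a.

Definition d_orientation (d : nat) (G : plane_graph)
    (o : {ffun {x : dart G | inner_dart x} -> 'I_(d - 2).+1}) : Prop :=
  fractional_orientation o /\
  forall v : vertex G, outdegree o v = if inner_vertex v then d else 0.

Definition clockwise_labelling (d : nat) (G : plane_graph)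
    (u : 'I_d -> vertex G) (l : {ffun dart G -> 'I_d}) : Prop :=
  [/\ (* The external face is walked the other way. *)
      forall x, if rface x == ext_face G
                then l x = ordS (l (next_corner x))
                else l (next_corner x) = ordS (l x),
      forall i x, origin x = u i -> l x = i
    & forall v, inner_vertex v ->
        #|[set x : dart G | (origin x == v) && (l (cw x) < l x)]| = 1].

(* Oriented subgraphs are sets A of darts: the edge of x \in A is oriented from
   [origin x] to [target x]. *)
Definition underlying (G : plane_graph) (A : {set dart G}) : {set dart G} :=
  [set x | (x \in A) || (opp x \in A)].

Definition adjacent (G : plane_graph) (A : {set dart G}) : rel (vertex G) :=
  [rel v w | [exists x in A, (origin x == v) && (target x == w)]].

Definition acyclic (G : plane_graph) (A : {set dart G}) : Prop :=
  forall p : seq (dart G),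
    all (mem (underlying A)) p ->
    cycle [rel x y | target x == origin y] p ->
    uniq (map origin p) -> uniq (map (@edge G) p) -> p = [::].

Definition oriented_forest (G : plane_graph) (A : {set dart G}) : Prop :=
  (forall x, x \in A -> opp x \notin A) /\ acyclic A.

(* The forest A has vertex set W, each of its trees contains exactly one vertex
   u j with j \in J, and is oriented toward it. *)
Definition rooted_spanning (d : nat) (G : plane_graph) (u : 'I_d -> vertex G)
    (W : {set vertex G}) (J : {set 'I_d}) (A : {set dart G}) : Prop :=
  (forall x, x \in A -> (origin x \in W) && (target x \in W)) /\
  forall v, v \in W ->
    exists j, [/\ j \in J, connect (adjacent A) v (u j)
      & forall k, k \in J ->
          connect (adjacent (underlying A)) v (u k) -> k = j].

(* Weak cyclic order of arcs with the same origin: for some starting index c,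
   the arcs e c, e (c + 1), ..., e (c + d - 1), possibly with repetitions, are
   met in this order in a single clockwise turn starting from e c. *)
Definition clockwise_around (d : nat) (G : plane_graph) (e : 'I_d -> dart G) :
    Prop :=
  exists c, sorted leq
    [seq findex cw (e c) (e (iter j (@ordS d) c)) | j <- iota 0 d].

(* Turning clockwise from a, x is met after a and before b is next met.  If
   a = b, this is the whole turn except a itself. *)
Definition strictly_between (G : plane_graph) (a b x : dart G) : bool :=
  findex cw (cw a) x < findex cw (cw a) b.

Definition schnyder_decomposition (d : nat) (G : plane_graph)
    (u : 'I_d -> vertex G) (F : {ffun 'I_d -> {set dart G}}) : Prop :=
  [/\ forall i, oriented_forest (F i) /\ (forall x, x \in F i -> inner_dart x),
      forall x, inner_dart x ->
        #|[set i | x \in underlying (F i)]| = d - 2,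
      forall i, rooted_spanning u (~: [set u i; u (ordS i)])
                  (~: [set i; ordS i]) (F i)
    & forall v, inner_vertex v -> exists e : 'I_d -> dart G,
        [/\ forall i x, (origin x == v) && (x \in F i) = (x == e i),
            clockwise_around e
          & forall i x, origin x = v -> opp x \in F i ->
              strictly_between (e (ordS i)) (e (ord_pred i)) x]].

(* Main.v *)
(** Write [l x] for the color of the corner clockwise from the arc x, and let the
   value of an arc be the increase modulo d of the labels across it.  Around
   an edge the values add up to -2 modulo d, and Euler's relation forces d - 2.
   Conversely an orientation prescribes the increments of the labels along
   every step from corner to corner; they are consistent around vertices, faces
   and edges, hence exact because the sphere is simply connected (proved by
   counting flows over Z/d).  The forest F_i consists of the arcs across which
   the labels pass the value i.  A trap of F_i (a nonempty set of arcs of F_i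
   containing a successor of each of its arcs) cuts the sphere: summing the
   values of the arcs on the side not containing the external face shows that
   this side has Euler characteristic 0, so that the connected external side
   would have Euler characteristic 2, whereas a counting of flows over Z/2
   bounds it by 1.  Conversely, in a Schnyder decomposition a corner is labelled
   by the next outgoing color, and the condition on incoming arcs yields the
   face rule. *)
From mathcomp Require Import all_boot all_algebra functions zify ring.
Require Import Defs.

Set Implicit Arguments.
Unset Strict Implicit.
Unset Printing Implicit Defensive.

Import GRing.Theory.

(** * Flows on a connected graph *)

Section Flows.

Variables (A : finZmodType) (I T : finType) (s t : I -> T).
Local Open Scope ring_scope.

Definition divergence (k : {ffun I -> A}) (a : T) : A :=
  \sum_(i | s i == a) k i - \sum_(i | t i == a) k i.

Lemma divergenceD k k' a :
  divergence (k + k') a = divergence k a + divergence k' a.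
Proof.
rewrite /divergence; under eq_bigr do rewrite ffunE.
under [X in _ - X]eq_bigr do rewrite ffunE.
by rewrite !big_split /= opprD addrACA.
Qed.

Lemma divergence_sum (J : finType) (F : J -> {ffun I -> A}) a :
  divergence (\sum_j F j) a = \sum_j divergence (F j) a.
Proof.
have divergence0 : divergence 0 a = 0.
  by rewrite /divergence !big1 ?subrr // => i _; rewrite ffunE.
by apply: (big_morph (divergence ^~ a) (fun k k' => divergenceD k k' a)).
Qed.

Lemma divergence_single i c a :
  divergence [ffun j => if j == i then c else 0] a =
  (if s i == a then c else 0) - (if t i == a then c else 0).
Proof.
have single (P : pred I) :
    \sum_(j | P j) [ffun j => if j == i then c else 0] j =
    if P i then c else 0.
  under eq_bigr do rewrite ffunE.
  by rewrite -big_mkcondr /= big_mkcond (bigD1 i) //= eqxx andbT big1 ?addr0 //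
    => j /negPf ->; rewrite andbF.
by rewrite /divergence !single.
Qed.

Variable I0 : {set I}.

Definition generator_rel : rel T :=
  [rel a b | [exists i in I0,
     (s i == a) && (t i == b) || (s i == b) && (t i == a)]].

(** The path is an undirected walk. An arc followed from source to target receives [- c] and one
    followed backwards [c], so the contributions at intermediate nodes cancel. *)
Lemma path_flow (c : A) a b : connect generator_rel a b ->
  exists2 k : {ffun I -> A}, {in ~: I0, forall i, k i = 0}
    & forall v, divergence k v =
        (if v == b then c else 0) - (if v == a then c else 0).
Proof.
move=> /connectP[p]; elim: p a => [|a' p IHp] a /=.
  move=> _ ->; exists 0 => [i _|v]; first by rewrite ffunE.
  by rewrite subrr /divergence !big1 ?subrr // => i _; rewrite ffunE.
move=> /andP[/exists_inP[i I0i aia'] /IHp{IHp} /[apply] -[k k0 kE]].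
pose sgn := (s i == a) && (t i == a').
exists (k + [ffun j => if j == i then (if sgn then - c else c) else 0]).
  move=> j; rewrite inE => jI0; rewrite ffunE k0 ?inE // ffunE add0r ifN //.
  by apply: contraNneq jI0 => ->.
move=> v; rewrite divergenceD kE divergence_single.
rewrite -addrA; congr (_ + _).
rewrite {}/sgn.
case: (boolP (_ && _)) aia' => [/andP[/eqP-> /eqP->] _|_ /= /andP[/eqP-> /eqP->]];
  rewrite !(eq_sym v); case: (a == v); case: (a' == v);
  by rewrite !(opprK, oppr0, addr0, add0r, subrr, addNr, sub0r).
Qed.

(** The circulations supported on a connected graph have rank at most |I0| - |T0| + 1; the extra
    factor [#|A|] on the right avoids a subtraction in the exponent. *)
Lemma flow_bound (T0 : {set T}) (r : T) (K : {set {ffun I -> A}}) :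
  r \in T0 -> {in T0, forall a, connect generator_rel r a} ->
  {in K, forall k : {ffun I -> A}, {in ~: I0, forall i, k i = 0} /\
                   forall a, divergence k a = 0} ->
  (#|K| * #|A| ^ #|T0| <= #|A| ^ #|I0|.+1)%N.
Proof.
move=> rT0 conn flowK.
have /fin_all_exists[psi psiP] (ac : T * A) : exists k : {ffun I -> A},
    ac.1 \in T0 -> {in ~: I0, forall i, k i = 0} /\
    forall v, divergence k v =
      (if v == ac.1 then ac.2 else 0) - (if v == r then ac.2 else 0).
  case: (boolP (ac.1 \in T0)) => [/conn/(path_flow ac.2)[k k0 kE]|]; last first.
    by exists 0.
  by exists k.
pose H := [set h : {ffun T -> A} | h \in pffun_on 0 (T0 :\ r) predT].
have cardH : #|H| = (#|A| ^ #|T0 :\ r|)%N.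
  by rewrite cardsE card_pffun_on.
pose Q := [set k : {ffun I -> A} | k \in pffun_on 0 I0 predT].
have cardQ : #|Q| = (#|A| ^ #|I0|)%N by rewrite cardsE card_pffun_on.
(* Each value [h a] is routed from [a] to the root [r]. The divergence away from [r] recovers [h],
   and then [k], so [comb] is injective. *)
pose comb (kh : {ffun I -> A} * {ffun T -> A}) :=
  kh.1 + \sum_(a in T0) psi (a, kh.2 a).
have inP (J : finType) (J0 : {set J}) (k : {ffun J -> A}) :
    k \in pffun_on 0 J0 predT <-> {in ~: J0, forall i, k i = 0}.
  split=> [/pffun_onP[/subsetP supp _] i|k0].
    by rewrite inE; apply: contraNeq => ki; apply: supp.
  apply/pffun_onP; split=> //; apply/subsetP => i; rewrite inE.
  by apply: contraR => iJ0; rewrite k0 ?inE.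
have combQ : comb @: setX K H \subset Q.
  apply/subsetP => _ /imsetP[[k h] /setXP[/flowK[k0 _] hH] ->].
  rewrite inE; apply/inP => i iI0; rewrite /comb /= ffunE k0 // sum_ffunE.
  rewrite big1 ?addr0 // => a aT0.
  by have /= [-> //] := psiP (a, h a) aT0.
have comb_inj : {in setX K H &, injective comb}.
  move=> [k h] [k' h'] /setXP[kK]; rewrite inE => /inP h0.
  move=> /setXP[k'K]; rewrite inE => /inP h'0 eqc.
  suff eqh : h = h'.
    by move: eqc; rewrite /comb /= eqh => /addIr ->.
  apply/ffunP => v; case: (boolP (v \in T0 :\ r)) => [|vT0]; last first.
    by rewrite h0 ?h'0 // inE.
  rewrite !inE => /andP[vr vT0].
  have divE k1 h1 : k1 \in K -> divergence (comb (k1, h1)) v = h1 v.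
    move=> /flowK[_ k1E]; rewrite divergenceD k1E add0r big_mkcond.
    rewrite divergence_sum (bigD1 v) //= vT0.
    have /= [_ ->] := psiP (v, h1 v) vT0.
    rewrite eqxx (negPf vr) subr0 big1 ?addr0 // => a av.
    case: ifP => aT0; last first.
      by rewrite /divergence !big1 ?subrr // => i _; rewrite ffunE.
    by have /= [_ ->] := psiP (a, h1 a) aT0; rewrite eq_sym !ifN ?subr0.
  by rewrite -(divE k h) // eqc divE.
have := subset_leq_card combQ; rewrite card_in_imset // cardsX cardH cardQ.
rewrite (cardsD1 r T0) rT0 expnD expn1 expnS mulnCA.
by move/(leq_mul (leqnn #|A|)).
Qed.

End Flows.

(** * Rotation systems *)

Section PlaneGraph.

Variable G : plane_graph.
Implicit Types (x y : dart G) (v : vertex G) (f : face G).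

Lemma cwK : cancel (@cw G) (finv cw).
Proof. exact: finv_f (@cw_inj G). Qed.

Lemma pred_cwK : cancel (finv cw) (@cw G).
Proof. exact: f_finv (@cw_inj G). Qed.

Lemma opp_inj : injective (@opp G).
Proof. exact: inv_inj (@oppK G). Qed.

Lemma next_corner_inj : injective (@next_corner G).
Proof. by move=> x y /(can_inj pred_cwK)/opp_inj. Qed.

Lemma opp_neq x : opp x != x.
Proof. by apply: contraNneq (loopless x) => ->. Qed.

Lemma next_opp x : next_corner (opp x) = finv cw x.
Proof. by rewrite /next_corner oppK. Qed.

Lemma origin_cw x : origin (cw x) = origin x.
Proof. by apply/eqP; rewrite eq_sym originP fconnect1. Qed.

Lemma origin_pred x : origin (finv cw x) = origin x.
Proof. by rewrite -{2}[x]pred_cwK origin_cw. Qed.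

Lemma rface_next x : rface (next_corner x) = rface x.
Proof. by apply/eqP; rewrite eq_sym rfaceP fconnect1. Qed.

Lemma rface_opp x : rface (opp x) = rface (finv cw x).
Proof. by rewrite -next_opp rface_next. Qed.

Lemma origin_next x : origin (next_corner x) = target x.
Proof. exact: origin_pred. Qed.

Lemma origin_ind (P : dart G -> Prop) x :
  (forall y, origin y = origin x -> P y -> P (cw y)) -> P x ->
  forall y, origin y = origin x -> P y.
Proof.
move=> Pcw Px y /esym/eqP; rewrite originP => /iter_findex <-.
elim: (findex cw x y) => // m IHm; apply: Pcw => //=.
by elim: m {IHm} => //= m; rewrite origin_cw.
Qed.

(** Connectedness of the graph makes [cw] and [opp] act transitively on darts. *)
Lemma dart_ind (P : pred (dart G)) x :
  (forall y, P y -> P (cw y)) -> (forall y, P y -> P (opp y)) -> P x ->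
  forall y, P y.
Proof.
move=> Pcw Popp Px.
pose Q v := [forall (z | origin z == v), P z].
have QE z : P z -> Q (origin z).
  move=> Pz; apply/forall_inP => y /eqP; move: y.
  by apply: origin_ind => // y _; apply: Pcw.
move=> y; suff /forall_inP : Q (origin y) by apply.
rewrite -[Q _]/(origin y \in Q).
have closedQ : closed [rel a b |
    [exists z, (origin z == a) && (origin (opp z) == b)]] Q.
  apply: intro_closed.
    apply: sym_connect_sym => a b; apply/existsP/existsP => -[z /andP[za zb]];
    by exists (opp z); rewrite oppK za zb.
  move=> a b /existsP[z /andP[/eqP <- /eqP <-]] /forall_inP Qz.
  by apply/QE/Popp/Qz.
rewrite -(closed_connect closedQ (connected (origin x) (origin y))).
exact: QE Px.
Qed.

Lemma sum_cw (R : nmodType) (F : dart G -> R) v :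
  (\sum_(x | origin x == v) F (cw x) = \sum_(x | origin x == v) F x)%R.
Proof.
by rewrite [RHS](reindex_inj (@cw_inj G)); apply: eq_bigl => x; rewrite origin_cw.
Qed.

Lemma sum_next (R : nmodType) (F : dart G -> R) f :
  (\sum_(x | rface x == f) F (next_corner x) = \sum_(x | rface x == f) F x)%R.
Proof.
by rewrite [RHS](reindex_inj next_corner_inj); apply: eq_bigl => x; rewrite rface_next.
Qed.

Lemma edge_opp x : edge (opp x) = edge x.
Proof. by rewrite /edge oppK setUC. Qed.

Lemma eq_edge x y : (edge x == edge y) = (x == y) || (x == opp y).
Proof.
apply/eqP/orP => [|[/eqP->|/eqP->]]; rewrite ?edge_opp // => /setP/(_ x).
by rewrite !inE eqxx /= => /esym/orP.
Qed.

Lemma sum_edge (R : nmodType) (F : dart G -> R) x :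
  (\sum_(y | edge y == edge x) F y = F x + F (opp x))%R.
Proof.
rewrite (bigD1 x) //= (bigD1 (opp x)) /=; last by rewrite edge_opp eqxx opp_neq.
rewrite big1 ?addr0 // => y; rewrite eq_edge.
by case: (y == x); case: (y == opp x).
Qed.

Lemma card_edges (D : {set dart G}) : {in D, forall x, opp x \in D} ->
  #|D| = 2 * #|@edge G @: D|.
Proof.
move=> oppD; rewrite -sum1_card (partition_big_imset (@edge G)) /=.
rewrite mulnC -sum_nat_const; apply: eq_bigr => _ /imsetP[x Dx ->].
rewrite -[RHS](sum_edge (fun=> 1 : nat) x); apply: eq_bigl => y.
apply: andb_idl; rewrite eq_edge => /orP[] /eqP -> //; exact: oppD.
Qed.

Lemma card_darts : #|vertex G| + #|face G| = #|@edge G @: setT| + 2.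
Proof.
rewrite euler; congr (_ + 2); apply: eq_card => e.
by apply/imsetP/imsetP => -[x _ ->]; exists x.
Qed.

(** * Exactness of closed forms on the sphere *)

Section Exactness.
Local Open Scope ring_scope.

Variable A : finZmodType.

(** In this incidence graph a dart gives two arcs, from its vertex and from its right face to its
    edge. With [alpha] and [beta] on them, zero divergence means closedness. Edges are coded among
    all sets of darts, hence the restriction to [T0] below. *)
Let node := (vertex G + face G + {set dart G})%type.
Let source (i : dart G + dart G) : node :=
  match i with inl x => inl (inl (origin x)) | inr x => inl (inr (rface x)) end.
Let sink (i : dart G + dart G) : node :=
  match i with inl x | inr x => inr (edge x) end.

(* First homology of the sphere vanishes: a 1-form on the graph of corners,
   given by [alpha] on clockwise steps around vertices and by [beta] on steps
   along face contours, is exact as soon as it is closed around vertices, faces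
   and edges. *)
Lemma closed_form_exact (alpha beta : dart G -> A) :
  (forall v, \sum_(x | origin x == v) alpha x = 0) ->
  (forall f, \sum_(x | rface x == f) beta x = 0) ->
  (forall x, alpha x + beta x + (alpha (opp x) + beta (opp x)) = 0) ->
  exists l : dart G -> A, (forall x, l x = l (finv cw x) + alpha x) /\
                          forall x, l (next_corner x) = l x + beta x.
Proof.
move=> sum_v sum_f sum_e; have [x0 _] := rface_surj (ext_face G).
pose K := [set k : {ffun dart G + dart G -> A} |
             [forall a, divergence source sink k a == 0]].
have divE k a : divergence source sink k a =
    match a with
    | inl (inl v) => \sum_(x | origin x == v) k (inl x)
    | inl (inr f) => \sum_(x | rface x == f) k (inr x)
    | inr e => - \sum_(x | edge x == e) (k (inl x) + k (inr x))
    end.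
  rewrite /divergence !big_sumType /=; case: a => [[v|f]|e] /=.
  - by rewrite [X in _ - (X + _)]big1 ?[X in _ - (_ + X)]big1 //
      [X in _ + X - _]big1 // ?addr0 ?subr0.
  - by rewrite [X in _ - (X + _)]big1 ?[X in _ - (_ + X)]big1 //
      [X in X + _ - _]big1 // ?addr0 ?add0r ?subr0.
  by rewrite big_split /= [X in X + _ - _]big1 // [X in _ + X - _]big1 //
      ?addr0 ?add0r ?subr0.
pose T0 : {set node} :=
  [set a | if a is inr e then e \in @edge G @: setT else true].
have conn : {in T0, forall a,
    connect (generator_rel source sink setT) (inr (edge x0)) a}.
  have step (i : dart G + dart G) :
      connect (generator_rel source sink setT) (source i) (sink i) /\
      connect (generator_rel source sink setT) (sink i) (source i).
    by split; apply: connect1; apply/exists_inP; exists i; rewrite ?eqxx ?orbT.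
  have connE x : connect (generator_rel source sink setT)
      (inr (edge x0)) (inr (edge x)).
    move: x; apply: (@dart_ind (fun x => connect _ _ (inr (edge x))) x0) => [x|x|].
    - move=> /connect_trans; apply.
      have [_ /connect_trans] := step (inl x); apply.
      by have [+ _] := step (inl (cw x)); rewrite /= origin_cw.
    - by rewrite edge_opp.
    exact: connect0.
  case=> [[v _|f _]|e]; last by rewrite inE => /imsetP[x _ ->]; exact: connE.
  - have [x <-] := origin_surj v; apply: connect_trans (connE x) _.
    by have [] := step (inl x).
  have [x <-] := rface_surj f; apply: connect_trans (connE x) _.
  by have [] := step (inr x).
have x0T : inr (edge x0) \in T0 by rewrite inE imset_f.
have := flow_bound x0T conn (K := K).
set E := #|@edge G @: setT|.
have cardD : #|dart G| = (2 * E)%N.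
  by rewrite -cardsT; apply: card_edges => x; rewrite inE.
have cardT0 : #|T0| = (2 * E + 2)%N.
  have -> : #|T0| = (#|vertex G| + #|face G| + E)%N.
    rewrite /E -!sum1_card big_sumType /= big_sumType /=; congr (_ + _ + _)%N;
    by apply: eq_bigl => a; rewrite !inE.
  by rewrite card_darts -/E; lia.
rewrite cardT0 cardsT card_sum cardD => boundK.
have {}boundK : (#|K| * #|A| ^ (2 * E + 2) <= #|A| ^ (2 * E + 2 * E).+1)%N.
  apply: boundK => k; rewrite inE => /forallP divk; split=> [i|a].
    by rewrite !inE.
  exact/eqP.
(* A coboundary determines the labels up to a constant only, so they are normalised to vanish at
   [x0]. *)
pose L := [set l : {ffun dart G -> A} | l \in pffun_on 0 [set~ x0] predT].
pose cob (l : {ffun dart G -> A}) : {ffun dart G + dart G -> A} :=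
  [ffun i => match i with inl x => l x - l (finv cw x)
                        | inr x => l (next_corner x) - l x end].
have cob_inj : {in L &, injective cob}.
  move=> l l'; rewrite !inE => /pffun_onP[supp _] /pffun_onP[supp' _] eql.
  have at0 (h : {ffun dart G -> A}) :
      0.-support h \subset [set~ x0] -> h x0 = 0.
    move=> /subsetP/(_ x0); rewrite !inE eqxx => h0.
    by apply/eqP/negPn/negP => /h0.
  apply/ffunP => x; apply/eqP; rewrite -subr_eq0; move: x.
  have eqcw x : l (cw x) - l x = l' (cw x) - l' x.
    by have /ffunP/(_ (inl (cw x))) := eql; rewrite !ffunE cwK.
  have eqnx x : l (next_corner x) - l x = l' (next_corner x) - l' x.
    by have /ffunP/(_ (inr x)) := eql; rewrite !ffunE.
  have swap (a b c e : A) : a - b = c - e -> a - c = b - e.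
    by move/eqP; rewrite subr_eq => /eqP ->; rewrite addrC addrA addKr addrC.
  apply: (@dart_ind (fun x => l x - l' x == 0) x0) => [x|x|].
  - by rewrite (swap _ _ _ _ (eqcw x)).
  - by rewrite -(swap _ _ _ _ (eqnx x)) -(swap _ _ _ _ (eqcw _)) pred_cwK.
  by rewrite !at0 // subrr.
have cobK : cob @: L \subset K.
  apply/subsetP => _ /imsetP[l _ ->]; rewrite inE; apply/forallP => a.
  rewrite divE; case: a => [[v|f]|e].
  - under eq_bigr do rewrite ffunE.
    rewrite sumrB -(sum_cw (fun x => l (finv cw x))).
    by under [X in _ - X]eq_bigr do rewrite cwK; rewrite subrr.
  - under eq_bigr do rewrite ffunE.
    by rewrite sumrB sum_next subrr.
  rewrite oppr_eq0; case: (boolP (e \in @edge G @: setT)) => [/imsetP[x _ ->]|eE].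
    rewrite sum_edge !ffunE next_opp /next_corner.
    rewrite (addrC (l x - _)) (addrC (l (opp x) - _)).
    by rewrite !addrA !subrK subrr.
  rewrite big1 // => x /eqP xe.
  by rewrite -xe imset_f in eE.
have A_gt0 : (0 < #|A|)%N by apply/card_gt0P; exists 0.
have cardL : #|cob @: L| = (#|A| ^ (2 * E).-1)%N.
  by rewrite card_in_imset // cardsE card_pffun_on cardsC1 cardD.
(* There are 2E + 2 nodes by Euler's relation and 4E arcs, so at most 2E - 1 degrees of freedom for
   closed forms; the normalised labels already have 2E - 1. *)
have /eqP eqK : cob @: L == K.
  rewrite eqEcard cobK cardL.
  rewrite -(@leq_pmul2r (#|A| ^ (2 * E + 2))) ?expn_gt0 ?A_gt0 //.
  apply: leq_trans boundK _; rewrite -expnD leq_eqVlt; apply/orP; left.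
  apply/eqP; congr (_ ^ _)%N.
  have : (0 < #|dart G|)%N by apply/card_gt0P; exists x0.
  by rewrite cardD; lia.
have : [ffun i => match i with inl x => alpha x | inr x => beta x end] \in K.
  rewrite inE; apply/forallP => a; rewrite divE; case: a => [[v|f]|e].
  - by under eq_bigr do rewrite ffunE; rewrite sum_v.
  - by under eq_bigr do rewrite ffunE; rewrite sum_f.
  rewrite oppr_eq0; case: (boolP (e \in @edge G @: setT)) => [/imsetP[x _ ->]|eE].
    by rewrite sum_edge !ffunE sum_e.
  rewrite big1 // => x /eqP xe.
  by rewrite -xe imset_f in eE.
rewrite -eqK => /imsetP[l _ /ffunP cobl]; exists l; split=> x.
  by have := cobl (inl x); rewrite !ffunE => ->; rewrite addrC subrK.
by have := cobl (inr x); rewrite !ffunE => ->; rewrite addrC subrK.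
Qed.

End Exactness.
End PlaneGraph.

(** * The external face and Euler's relation *)

Lemma val_addZ n (a b : 'I_n.+3) :
  (a + b)%R = (if a + b < n.+3 then a + b else a + b - n.+3) :> nat.
Proof.
rewrite /=; case: ltnP => [/modn_small //|le]; 
  rewrite -[in LHS](subnK le) modnDr.
by rewrite modn_small //; have := ltn_ord a; have := ltn_ord b; lia.
Qed.

Lemma val_subZ n (a b : 'I_n.+3) :
  (a - b)%R = (if b <= a then a - b else a + n.+3 - b) :> nat.
Proof.
have := val_addZ (a - b)%R b; rewrite subrK.
have := ltn_ord (a - b)%R; have := ltn_ord a; have := ltn_ord b.
by case: ifP => ?; case: ifP; lia.
Qed.

Lemma val_oneZ n : (1%R : 'I_n.+3) = 1 :> nat.
Proof. by []. Qed.

Lemma ordSE n (i : 'I_n.+3) : ordS i = (i + 1)%R.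
Proof. by apply: val_inj; rewrite /= addn1. Qed.

Lemma ord_predE n (i : 'I_n.+3) : ord_pred i = (i - 1)%R.
Proof. by apply: (addIr 1%R); rewrite subrK -ordSE ord_predK. Qed.

Section Angulation.

Variables (n : nat) (G : plane_graph) (u : 'I_n.+3 -> vertex G).
Hypotheses (hG : d_angulation n.+3 G) (hu : external_contour u).
Implicit Types (x y : dart G) (v : vertex G) (f : face G) (i j : 'I_n.+3).

Lemma u_inj : injective u. Proof. exact: hu.1. Qed.

(** With the external face on their right, its darts run along the contour backwards. The d darts
    given by [hu] are distinct, and this face has degree d, so there are no others. *)
Lemma ext_dart_contour : exists y : 'I_n.+3 -> dart G,
  [/\ forall i, origin (y i) = u (i + 1)%R, forall i, target (y i) = u i
    & forall x, (rface x == ext_face G) = (x \in codom y)].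
Proof.
have /fin_all_exists[y yP] i : exists y,
    [/\ rface y = ext_face G, origin y = u (i + 1)%R & target y = u i].
  by have [x [xf xi xt]] := hu.2 i; exists (opp x); rewrite /target oppK -ordSE.
have y_inj : injective y.
  move=> i j eqy; apply: u_inj.
  by have [_ _ <-] := yP i; have [_ _ <-] := yP j; rewrite eqy.
exists y; split=> [i|i|x]; try by have [] := yP i.
have suby : codom y \subset [set x | rface x == ext_face G].
  by apply/subsetP => _ /codomP[i ->]; rewrite inE; apply/eqP; have [] := yP i.
have eqc : #|codom y| = #|[set x | rface x == ext_face G]|.
  by rewrite card_codom // card_ord; exact/esym/hG.
by have /subset_cardP/(_ suby)/(_ x) := eqc; rewrite inE.
Qed.

Lemma ext_dart x : rface x = ext_face G ->
  exists i, origin x = u (i + 1)%R /\ target x = u i.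
Proof.
have [y [yo yt yE]] := ext_dart_contour.
by move/eqP; rewrite yE => /codomP[i ->]; exists i.
Qed.

(** An edge with the external face on both sides would give 2 = 0 modulo d, against d at least 3. *)
Lemma ext_dart_opp x : rface x = ext_face G -> rface (opp x) != ext_face G.
Proof.
move=> /ext_dart[i [xo xt]]; apply/eqP => /ext_dart[j []].
rewrite /target oppK xo -/(target x) xt => /u_inj -> /u_inj.
move=> /(congr1 (@nat_of_ord _)); rewrite !val_addZ !val_oneZ.
by have := ltn_ord j; repeat case: ifP; lia.
Qed.

Lemma ext_vertexP v : reflect (exists i, v = u i) (ext_vertex v).
Proof.
apply: (iffP existsP) => [[x /andP[/eqP <- /eqP /ext_dart[i [-> _]]]]|[i ->]].
  by exists (i + 1)%R.
have [y [yo _ yE]] := ext_dart_contour.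
by exists (y (i - 1)%R); rewrite yo yE subrK eqxx codom_f.
Qed.

Lemma inner_vertex_ext i : inner_vertex (u i) = false.
Proof. by apply/negbTE/negPn/ext_vertexP; exists i. Qed.

Lemma inner_dart_opp x : inner_dart (opp x) = inner_dart x.
Proof. by rewrite /inner_dart oppK andbC. Qed.

Lemma inner_vertex_dart x : inner_vertex (origin x) -> inner_dart x.
Proof.
move=> /existsP nex; apply/andP; split; apply/eqP => xf; apply: nex.
  by exists x; rewrite xf !eqxx.
by exists (finv cw x); rewrite origin_pred -rface_opp xf !eqxx.
Qed.

Lemma card_inner_vertex : #|[set v : vertex G | inner_vertex v]| + n.+3 = #|vertex G|.
Proof.
have cu : #|[set v in codom u]| = n.+3 by rewrite cardsE (card_codom u_inj) card_ord.
rewrite -[RHS](cardsC [set v in codom u]) cu addnC; congr (_ + _).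
apply: eq_card => v; rewrite !inE /inner_vertex; congr (~~ _).
by apply/ext_vertexP/codomP.
Qed.

Lemma card_inner_dart : #|[set x : dart G | inner_dart x]| + 2 * n.+3 = #|dart G|.
Proof.
have ext2 : #|[set x : dart G | ~~ inner_dart x]| = 2 * n.+3.
  rewrite -(hG (ext_face G)) /face_degree.
  set X := [set x | rface x == _].
  have -> : [set x : dart G | ~~ inner_dart x] = X :|: opp @: X.
    apply/setP => x; rewrite !inE negb_and !negbK; congr (_ || _).
    apply/idP/imsetP => [xf|[y + ->]]; last by rewrite inE oppK.
    by exists (opp x); rewrite ?oppK ?inE.
  rewrite cardsU card_imset; last exact: opp_inj.
  rewrite (_ : _ :&: _ = set0) ?cards0 ?subn0 ?mul2n ?addnn //.
  apply/setP => x; rewrite !inE; apply/negbTE/negP => /andP[/eqP xf].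
  case/imsetP => y; rewrite inE => /eqP/ext_dart_opp + xy.
  by rewrite -xy xf eqxx.
rewrite -ext2 -[RHS](cardsC [set x | inner_dart x]); congr (_ + _).
by apply: eq_card => x; rewrite !inE.
Qed.

Lemma card_dart_faces : #|dart G| = #|face G| * n.+3.
Proof.
rewrite -sum1_card (partition_big (@rface G) predT) //= -sum_nat_const.
apply: eq_bigr => f _; rewrite sum1_card -(hG f).
by apply: eq_card => x; rewrite inE.
Qed.

Lemma euler_darts : 2 * #|vertex G| + 2 * #|face G| = #|dart G| + 4.
Proof.
rewrite -mulnDr card_darts mulnDr -card_edges ?cardsT //.

Qed.

(** Outdegree d at each internal vertex balances d - 2 per internal edge. This is Euler's relation
    multiplied by d, after removal of the external contour. *)
Lemma euler_inner : 2 * (#|[set v : vertex G | inner_vertex v]| * n.+3) =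
  #|[set x : dart G | inner_dart x]| * n.+1.
Proof.
have := card_inner_vertex; have := card_inner_dart.
have := euler_darts; have := card_dart_faces; nia.
Qed.

End Angulation.

(** * Labels and jumps *)

Lemma card_ord_lt m k : k <= m -> #|[set i : 'I_m | i < k]| = k.
Proof.
move=> le; rewrite -sum1dep_card -(big_ord_widen _ (fun=> 1) le).
by rewrite sum1_card card_ord.
Qed.

Section Labellings.

Variables (n : nat) (G : plane_graph) (u : 'I_n.+3 -> vertex G).
Implicit Types (x y : dart G) (v : vertex G) (f : face G) (i j : 'I_n.+3).

(* Turning clockwise across the arc x, the corner label increases by [jump l x]
   modulo d and passes the values i such that [colored l i x]; equivalently,
   [level l i], which counts labels from i + 1, wraps around. *)
Definition jump (l : dart G -> 'I_n.+3) x : nat := (l x - l (finv cw x))%R.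

Definition level (l : dart G -> 'I_n.+3) i x : nat := (l x - 1 - i)%R.

Definition colored (l : dart G -> 'I_n.+3) i x : bool := level l i x < jump l x.

Lemma level_lt l i x : level l i x < n.+3. Proof. exact: ltn_ord. Qed.

(** Both sides agree modulo d, and the level wraps around at most once across an arc. *)
Lemma jump_level l i x :
  jump l x + level l i (finv cw x) = level l i x + colored l i x * n.+3.
Proof.
rewrite /colored /jump /level !val_subZ !val_oneZ.
have := ltn_ord (l x); have := ltn_ord (l (finv cw x)); have := ltn_ord i.
by repeat case: ifP; case: ltnP; lia.
Qed.

Lemma coloredE l i x : colored l i x = (level l i x < level l i (finv cw x)).
Proof.
have := jump_level l i x; have : jump l x < n.+3 by exact: ltn_ord.
have : level l i x < n.+3 by exact: ltn_ord.
by case: colored; case: ltnP; lia.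
Qed.

(** Summed over a full turn, the levels in [jump_level] cancel. In particular every color has the
    same number of outgoing arcs at [v]. *)
Lemma sum_jump l i v : \sum_(x | origin x == v) jump l x =
  #|[set x | (origin x == v) && colored l i x]| * n.+3.
Proof.
have sum_pred : \sum_(x | origin x == v) level l i (finv cw x) =
                \sum_(x | origin x == v) level l i x.
  rewrite (reindex_inj (@cw_inj G)); apply: eq_big => x; first by rewrite origin_cw.
  by rewrite cwK.
have : \sum_(x | origin x == v) (jump l x + level l i (finv cw x)) =
       \sum_(x | origin x == v) (level l i x + colored l i x * n.+3).
  by apply: eq_bigr => x _; exact: jump_level.
rewrite !big_split /= sum_pred addnC => /addnI ->.
by rewrite -big_distrl /= -sum1dep_card big_mkcondr.
Qed.

Lemma card_colored l x : #|[set i | colored l i x]| = jump l x.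
Proof.
pose r i : 'I_n.+3 := (l x - 1 - i)%R.
have r_inj : injective r by move=> i j /addrI/oppr_inj.
have -> : [set i | colored l i x] = r @^-1: [set k : 'I_n.+3 | k < jump l x].
  by apply/setP => i; rewrite !inE.
by rewrite card_preimset // card_ord_lt // ltnW // ltn_ord.
Qed.

(** The level relative to the color -1 is the label itself, so descents are the arcs of that color,
    up to a shift by [cw]. *)
Lemma card_descents (l : dart G -> 'I_n.+3) v :
  #|[set x : dart G | (origin x == v) && (l (cw x) < l x)]| * n.+3 =
  \sum_(x | origin x == v) jump l x.
Proof.
rewrite (sum_jump l (- 1)%R); congr (_ * _); rewrite -!sum1dep_card.
rewrite [RHS](reindex_inj (@cw_inj G)); apply: eq_bigl => x.
by rewrite origin_cw coloredE /level !opprK !subrK cwK.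
Qed.

Hypotheses (hG : d_angulation n.+3 G) (hu : external_contour u).

Section Labelling.

Variable l : {ffun dart G -> 'I_n.+3}.
Hypothesis hl : clockwise_labelling u l.

Lemma label_next x : rface x != ext_face G -> l (next_corner x) = (l x + 1)%R.
Proof. by case: hl => /(_ x) + _ _ => /[swap] /negPf -> ->; rewrite ordSE. Qed.

Lemma label_pred x : inner_dart x -> l (finv cw x) = (l (opp x) + 1)%R.
Proof. by move=> /andP[_ /label_next]; rewrite next_opp. Qed.

Lemma label_ext i x : origin x = u i -> l x = i.
Proof. by case: hl => _ + _; apply. Qed.

Lemma jump_ext x : ~~ inner_vertex (origin x) -> jump l x = 0.
Proof.
move=> /negPn/(ext_vertexP hG hu)[i xi].
by rewrite /jump !(@label_ext i) ?origin_pred // subrr.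
Qed.

Lemma jump_ninner x : ~~ inner_dart x -> jump l x = 0.
Proof. by move=> xi; apply/jump_ext; apply: contra xi; exact: inner_vertex_dart. Qed.

Lemma sum_jump_vertex v :
  \sum_(x | origin x == v) jump l x = if inner_vertex v then n.+3 else 0.
Proof.
case: ifPn => vi; last by apply: big1 => x /eqP xv; rewrite jump_ext ?xv.
by rewrite -card_descents; case: hl => _ _ -> //; rewrite mul1n.
Qed.

Lemma sum_jump_inner : \sum_(x in [set x : dart G | inner_dart x]) jump l x =
  #|[set v : vertex G | inner_vertex v]| * n.+3.
Proof.
rewrite big_mkcond (eq_bigr (jump l)) => [|x _]; last first.
  by rewrite inE; case: ifPn => // /jump_ninner.
rewrite (partition_big (@origin G) predT) //= -sum_nat_const [RHS]big_mkcond.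
by apply: eq_bigr => v _; rewrite sum_jump_vertex inE.
Qed.

Lemma sum_opp (F : dart G -> nat) :
  \sum_(x in [set x : dart G | inner_dart x]) F (opp x) =
  \sum_(x in [set x : dart G | inner_dart x]) F x.
Proof.
rewrite [RHS](reindex_inj (@opp_inj G)); apply: eq_bigl => x.
by rewrite !inE inner_dart_opp.
Qed.

(* The two jumps add up to -2 modulo d, hence to at least d - 2; by Euler's
   relation they add up to d - 2 on average. *)
Lemma jump_opp x : inner_dart x -> jump l x + jump l (opp x) = n.+1.
Proof.
have ge y : inner_dart y -> n.+1 <= jump l y + jump l (opp y).
  move=> yi; have /andP[/label_next + _] := yi; have := label_pred yi.
  rewrite /jump /next_corner => -> ->; rewrite !val_subZ !val_addZ !val_oneZ.
  have := ltn_ord (l y); have := ltn_ord (l (opp y)).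
  by repeat case: ifP; lia.
have : \sum_(y in [set y : dart G | inner_dart y]) (jump l y + jump l (opp y)) =
       \sum_(y in [set y : dart G | inner_dart y]) n.+1.
  rewrite big_split /= sum_opp sum_nat_const -(euler_inner hG hu).
  by rewrite sum_jump_inner mul2n addnn.
have leif y : y \in [set y : dart G | inner_dart y] ->
    n.+1 <= jump l y + jump l (opp y) ?= iff (n.+1 == jump l y + jump l (opp y)).
  by rewrite inE => yi; split=> //; exact: ge.
move/esym/eqP; rewrite (leqif_sum leif) => /forall_inP eq xi.
by apply/esym/eqP/eq; rewrite inE.
Qed.

End Labelling.
End Labellings.

(** * From orientations to labellings *)

Section LabellingsAndWeights.

Variables (n : nat) (G : plane_graph) (u : 'I_n.+3 -> vertex G).
Hypotheses (hG : d_angulation n.+3 G) (hu : external_contour u).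
Implicit Types (x y : dart G) (v : vertex G) (f : face G) (i j : 'I_n.+3).

(** Jumps determine the label steps around vertices, the face rule those along contours, and the
    label at an external vertex is fixed. *)
Lemma labelling_jump_inj (l l' : {ffun dart G -> 'I_n.+3}) :
  clockwise_labelling u l -> clockwise_labelling u l' -> jump l =1 jump l' ->
  l = l'.
Proof.
move=> hl hl' eqj; have [z [zo _ _]] := ext_dart_contour hG hu.
apply/ffunP => x; apply/eqP; move: x.
have Pcw x : l x == l' x -> l (cw x) == l' (cw x).
  move=> /eqP eqx; have /val_inj := eqj (cw x).
  by rewrite !cwK eqx => /addIr ->.
apply: (@dart_ind _ (fun x => l x == l' x) (z ord0)) => // [x eqx|]; last first.
  by rewrite (label_ext hl (zo _)) (label_ext hl' (zo _)).
rewrite -[opp x]pred_cwK; apply: Pcw; rewrite -[finv _ _]/(next_corner x).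
move: hl hl' => [/(_ x) + _ _] [/(_ x) + _ _].
case: ifP => _; last by move=> -> ->; rewrite (eqP eqx).
by rewrite (eqP eqx) => -> /(@ordS_inj n.+3) ->.
Qed.

(** * Labellings with prescribed jumps *)

Section Existence.

Variable w : dart G -> nat.
Hypotheses (w_opp : forall x, inner_dart x -> w x + w (opp x) = n.+1)
  (w_ninner : forall x, ~~ inner_dart x -> w x = 0)
  (w_sum : forall v, \sum_(x | origin x == v) w x =
                     if inner_vertex v then n.+3 else 0).

Lemma weight_ext x i : origin x = u i -> w x = 0.
Proof.
move=> xi; have /eqP := w_sum (u i).
rewrite (inner_vertex_ext hG hu) sum_nat_eq0 => /forall_inP/(_ x) w0.
by apply/eqP/w0; rewrite xi.
Qed.

Lemma weight_lt x : w x < n.+3.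
Proof.
have [/w_opp|/w_ninner ->//] := boolP (inner_dart x); lia.
Qed.

Lemma labelling_of_weight :
  exists2 l, clockwise_labelling u l & jump l =1 w.
Proof.
have natd : (n.+3%:R = 0 :> 'I_n.+3)%R by apply: val_inj; rewrite Zp_nat /= modnn.
pose alpha x : 'I_n.+3 := ((w x)%:R)%R.
(* The sign follows the reversed walk around the external face. Around an internal edge the total is
   (d - 2) + 2 = 0 modulo d; around an external one the weights vanish and the two signs cancel. *)
pose beta x : 'I_n.+3 := (if rface x == ext_face G then - 1 else 1)%R.
have [v|f|x|l0 [l0a l0b]] := @closed_form_exact G 'I_n.+3 alpha beta.
- by rewrite -natr_sum w_sum; case: ifP.
- rewrite (eq_bigr (fun=> if f == ext_face G then - 1 else 1)%R); last first.
    by move=> x /eqP <-.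
  rewrite sumr_const (_ : #|_| = n.+3); last first.
    by rewrite -(hG f); apply: eq_card => x; rewrite inE.
  by rewrite -mulr_natr natd mulr0.
- rewrite addrACA -natrD; case: (boolP (inner_dart x)) => [xi|xi].
    rewrite w_opp //; move/andP: xi => [/negPf fx /negPf fox].
    by rewrite /beta fx fox -natd -(natrD _ 1 1) -natrD addn2.
  rewrite !w_ninner ?inner_dart_opp // add0r /beta.
  move: xi; rewrite negb_and !negbK => /orP[] /eqP xf.
    have /negPf -> := ext_dart_opp hG hu xf.
    by rewrite xf eqxx addNr.
  have /negPf := ext_dart_opp hG hu xf; rewrite oppK => ->.
  by rewrite xf eqxx subrr.
have [y [yo yt yE]] := ext_dart_contour hG hu.
have l0_const x z i : origin x = u i -> origin z = u i -> l0 x = l0 z.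
  move=> xi zi; apply: (@origin_ind _ (fun x => l0 x = l0 z) z) => //; last first.
    by rewrite xi zi.
  move=> t tz <-; rewrite l0a cwK /alpha (@weight_ext _ i) ?addr0 //.
  by rewrite origin_cw tz.
have l0_ext m : (l0 (y (m%:R - 1)) = l0 (y (- 1)) + m%:R)%R.
  elim: m => [|m IHm]; first by rewrite addr0 sub0r.
  rewrite mulrSr addrK addrA -IHm.
  have := l0b (y m%:R)%R; rewrite /beta yE codom_f.
  rewrite (@l0_const _ (y (m%:R - 1)) m%:R)%R ?origin_next ?yo ?subrK //.
  by move=> ->; rewrite subrK.
(* The dart [y (- 1)] starts at [u 0], which must be labelled 0; [l0_ext] then gives label i at each
   [u i]. *)
pose l := [ffun x => l0 x - l0 (y (- 1))]%R.
have jumpE x : jump l x = w x.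
  rewrite /jump !ffunE l0a opprB addrA subrK addrC addKr /alpha Zp_nat /=.
  by rewrite modn_small ?weight_lt.
exists l => //; split=> [x|i x xi|v vi].
- rewrite !ordSE !ffunE l0b /beta; case: (rface x == _); last by rewrite addrAC.
  by rewrite addrAC subrK.
- rewrite ffunE -[i in RHS]natr_Zp.
  rewrite (@l0_const x (y (i%:R - 1))%R i) ?yo ?subrK ?natr_Zp //.
  by rewrite -{1}[i]natr_Zp l0_ext addrC addKr natr_Zp.
apply/eqP; rewrite -(@eqn_pmul2r n.+3) // card_descents mul1n.
by rewrite (eq_bigr w) // w_sum vi.
Qed.

End Existence.
End LabellingsAndWeights.

(** * Color classes contain no trap *)

Section DualComponent.

Variables (G : plane_graph) (C : pred (dart G)).
Hypothesis C_opp : forall x, C (opp x) = C x.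
Implicit Types (x y : dart G) (v : vertex G) (f : face G).

Definition dual_rel : rel (face G) :=
  [rel f g | [exists x, [&& ~~ C x, rface x == f & rface (opp x) == g]]].

Definition ext_component : {set face G} :=
  [set f | connect dual_rel (ext_face G) f].

Lemma ext_component_ext : ext_face G \in ext_component.
Proof. by rewrite inE connect0. Qed.

Lemma ext_component_opp x : ~~ C x ->
  (rface (opp x) \in ext_component) = (rface x \in ext_component).
Proof.
wlog suff: x / ~~ C x -> rface x \in ext_component -> rface (opp x) \in ext_component.
  move=> sub Cx; apply/idP/idP; last exact: sub.
  by move/sub; rewrite C_opp oppK; apply.
move=> Cx; rewrite !inE => /connect_trans; apply; apply: connect1.
by apply/existsP; exists x; rewrite Cx !eqxx.
Qed.

Local Notation S := ext_component.

(* The Euler characteristic of the component S, without its boundary, is at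
   most 1: coboundaries of mod 2 functions on its vertices are flows on its
   dual graph, which is connected. *)
Lemma ext_component_bound x0 : C x0 ->
  2 * #|[set v | [forall (x | origin x == v), ~~ C x && (rface x \in S)]]|
    + 2 * #|S| <= #|[set x | ~~ C x && (rface x \in S)]| + 2.
Proof.
move=> Cx0; set N := [set v | _]; set D := [set x | _].
have oppD x : x \in D -> opp x \in D.
  by rewrite ![_ \in D]in_set C_opp => /andP[Cx]; rewrite ext_component_opp // Cx.
have cardD := card_edges oppD.
pose node := (face G + {set dart G})%type.
(* Each dual edge is subdivided: the dart [x] is the half joining its right face to the edge. *)
pose s x : node := inl (rface x); pose t x : node := inr (edge x).
pose T0 : {set node} :=
  [set a | match a with inl f => f \in S | inr e => e \in @edge G @: D end].
have extT0 : inl (ext_face G) \in T0 by rewrite inE ext_component_ext.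
have step x : x \in D ->
    connect (generator_rel s t D) (s x) (t x) /\
    connect (generator_rel s t D) (t x) (s x).
  by move=> Dx; split; apply: connect1; apply/exists_inP; exists x;
    rewrite ?eqxx ?orbT.
have connS f : f \in S -> connect (generator_rel s t D) (inl (ext_face G)) (inl f).
  rewrite inE => /connectP[p]; move: (ext_face G) ext_component_ext.
  elim: p f => [|g p IHp] f a Sa /=; first by move=> _ ->; exact: connect0.
  move=> /andP[/existsP[x /and3P[Cx /eqP xa /eqP xg]] pth lst].
  have Dx : x \in D by rewrite in_set Cx xa.
  have Sg : g \in S by rewrite -xg ext_component_opp // xa.
  apply: connect_trans (IHp f g Sg pth lst).
  rewrite -xa -xg; apply: connect_trans (step x Dx).1 _.
  by rewrite /t -edge_opp; exact: (step _ (oppD _ Dx)).2.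
have conn : {in T0, forall a,
    connect (generator_rel s t D) (inl (ext_face G)) a}.
  case=> [f|e]; rewrite inE; first exact: connS.
  move=> /imsetP[x Dx ->]; apply: connect_trans (step x Dx).1.
  by apply: connS; move: Dx; rewrite inE => /andP[].
have char2 (a : 'I_2) : (a + a = 0)%R by case: a => -[|[|//]] ?; apply: val_inj.
(* The functions [h] are supported on [N]. As they vanish at the origin of [x0] and the graph is
   connected, [cob] is injective on them. *)
pose cob (h : {ffun vertex G -> 'I_2}) : {ffun dart G -> 'I_2} :=
  [ffun x => h (origin x) + h (target x)]%R.
pose H := [set h : {ffun vertex G -> 'I_2} | h \in pffun_on 0%R N predT].
have H0 h v : h \in H -> v \notin N -> h v = 0%R.
  rewrite inE => /pffun_onP[/subsetP/(_ v) hN _].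
  by apply: contraNeq => ?; apply: hN; rewrite inE.
have H0x h x : h \in H -> x \notin D -> h (origin x) = 0%R.
  move=> hH xD; apply: H0 => //; apply: contra xD.
  rewrite [_ \in N]in_set [_ \in D]in_set.
  by move=> /forall_inP/(_ x); apply.
have := flow_bound extT0 conn (K := cob @: H).
rewrite card_in_imset; last first.
  move=> h h' hH h'H /ffunP eqh; apply/ffunP => v; apply/eqP.
  have [x <-] := origin_surj v; move: x.
  apply: (@dart_ind _ (fun x => h (origin x) == h' (origin x)) x0).
  - by move=> x; rewrite origin_cw.
  - move=> x /eqP eqx; have := eqh x; rewrite !ffunE eqx.
    by move/addrI/eqP.
  by rewrite !H0x // inE Cx0.
have -> : #|H| = 2 ^ #|N| by rewrite cardsE card_pffun_on card_ord.
have -> : #|T0| = #|S| + #|@edge G @: D|.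
  rewrite -!sum1_card big_sumType /=; congr (_ + _);
  by apply: eq_bigl => a; rewrite inE.
rewrite card_ord -expnD leq_exp2l // cardD => bound.
suff /bound : {in cob @: H, forall k : {ffun dart G -> 'I_2},
  {in ~: D, forall i, k i = 0%R} /\ forall a, divergence s t k a = 0%R} by lia.
(* Along a face contour every vertex value occurs twice, and the two halves of an edge carry equal
   values; both cancel modulo 2. *)
move=> _ /imsetP[h hH ->]; split=> [x|[f|e]].
- rewrite inE => xD; rewrite ffunE H0x // /target H0x ?addr0 //.
  by apply: contra xD => /oppD; rewrite oppK.
- rewrite /divergence [X in (_ - X)%R]big1 // subr0.
  under eq_bigr do rewrite ffunE -origin_next.
  by rewrite big_split /= (sum_next (fun x => h (origin x))) char2.
rewrite /divergence big1 // sub0r; apply/eqP; rewrite oppr_eq0.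
case: (pickP (fun x => edge x == e)) => [x /eqP <-|noe]; last first.
  by rewrite big_pred0.
rewrite (sum_edge (cob h)) !ffunE /target oppK (addrC (h (origin (opp x)))).
by rewrite char2.
Qed.

End DualComponent.

(** * Euler characteristics of the two sides of a trap *)

Section NoTrap.

Variables (n : nat) (G : plane_graph) (u : 'I_n.+3 -> vertex G).
Hypotheses (hG : d_angulation n.+3 G) (hu : external_contour u).
Variable l : {ffun dart G -> 'I_n.+3}.
Hypothesis hl : clockwise_labelling u l.
Implicit Types (x y : dart G) (v : vertex G) (f : face G) (i j : 'I_n.+3).

Lemma colored_inner i x : colored l i x -> inner_dart x.
Proof. by apply: contraTT => /(jump_ninner hG hu hl); rewrite /colored => ->. Qed.

Lemma level_next i x : rface x != ext_face G ->
  level l i (next_corner x) = if level l i x == n.+2 then 0 else (level l i x).+1.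
Proof.
move=> /(label_next hl) xf; rewrite /level xf !val_subZ !val_addZ !val_oneZ.
have := ltn_ord (l x); have := ltn_ord i.
by repeat case: ifP; lia.
Qed.

Lemma colored_next i x : colored l i x ->
  level l i (next_corner x) = (level l i x).+1.
Proof.
move=> xi; have /andP[xf _] := colored_inner xi.
rewrite level_next // ifN //; move: xi; rewrite coloredE.
by have := level_lt l i (finv cw x); lia.
Qed.

Lemma colored_pred i x : colored l i x ->
  level l i (finv cw x) = (level l i (opp x)).+1.
Proof.
move=> xi; have /andP[_ xf] := colored_inner xi.
have := level_next i xf; rewrite next_opp.
by move: xi; rewrite coloredE; case: ifP => _; lia.
Qed.

(** A jump is at most d - 2, so a wrap around lowers the level by at least 2. *)
Lemma level_gap i x : colored l i x -> level l i x + 1 < level l i (finv cw x).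
Proof.
move=> xi; have := jump_level l i x; rewrite xi.
by have := jump_opp hG hu hl (colored_inner xi); lia.
Qed.

(** The face steps on both sides of [x] raise the level by one without wrapping. A drop of at least
    2 across [x] is therefore no drop across [opp x]. *)
Lemma colored_opp i x : colored l i x -> ~~ colored l i (opp x).
Proof.
move=> xi; have := level_gap xi; rewrite coloredE (colored_pred xi).
by rewrite -[finv cw (opp x)]/(next_corner x) (colored_next xi); lia.
Qed.

Lemma colored_out i v : inner_vertex v ->
  exists x, forall y, (origin y == v) && colored l i y = (y == x).
Proof.
move=> vi; have := sum_jump l i v; rewrite (sum_jump_vertex hG hu hl) vi.
rewrite -{1}[n.+3]mul1n => /eqP; rewrite eqn_pmul2r // eq_sym.
by move=> /cards1P[x /setP xP]; exists x => y; have := xP y; rewrite !inE.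
Qed.

Section Trap.

Variables (i : 'I_n.+3) (X : {set dart G}).
Hypotheses (Xi : {in X, forall x, colored l i x})
  (Xout : {in X, forall x, exists2 y, y \in X & origin y = target x}).

(** [C] is the cut made by the edges of the trap, and [r x] says that the corner [x] lies on a side
    cut off from the external face. *)
Let C x := (x \in X) || (opp x \in X).
Local Notation S := (ext_component C).
Let r x := rface x \notin S.

Let C_opp x : C (opp x) = C x. Proof. by rewrite /C oppK orbC. Qed.

Let r_opp x : ~~ C x -> r (opp x) = r x.
Proof. by move=> Cx; rewrite /r (ext_component_opp C_opp). Qed.

Let r_pred x : r (finv cw x) = r (opp x).
Proof. by rewrite /r rface_opp. Qed.

Let r_ext x : r x -> rface x != ext_face G.
Proof. by apply: contraNneq => ->; exact: ext_component_ext. Qed.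

Let r_inner x : r x && r (opp x) -> inner_dart x.
Proof. by move=> /andP[/r_ext xf /r_ext oxf]; apply/andP. Qed.

Let opp_notin x : x \in X -> opp x \notin X.
Proof. by move=> /Xi/colored_opp; apply: contra => /Xi. Qed.

(** Such an arc lies on the cut. Whichever of [x] and [opp x] is colored, the contour step cannot
    wrap the level around. *)
Lemma boundary_next x : r x && ~~ r (opp x) ->
  level l i (next_corner x) = (level l i x).+1.
Proof.
move=> /andP[rx rox]; have : C x by apply: contraLR rx => /r_opp <-.
move=> /orP[/Xi/colored_next //|/Xi]; rewrite coloredE.
rewrite -[finv cw (opp x)]/(next_corner x) level_next ?r_ext //.
by case: ifP.
Qed.

(** The sum over all inner corners is reindexed by clockwise predecessors; by [boundary_next] each
    boundary arc leaves an excess of one. *)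
Lemma sum_level_inside :
  \sum_(x | r x && r (opp x)) level l i x =
  \sum_(x | r x && r (opp x)) level l i (finv cw x) +
  #|[set x | r x && ~~ r (opp x)]|.
Proof.
have : \sum_(x | r x) level l i x =
       \sum_(x | r (opp x)) level l i (finv cw x).
  rewrite (reindex_inj (can_inj (@pred_cwK G))).
  by apply: eq_bigl => x; rewrite r_pred.
rewrite (bigID (fun x => r (opp x))) [in RHS](bigID r) /=.
under [in RHS]eq_bigl do rewrite andbC.
suff -> : \sum_(x | r (opp x) && ~~ r x) level l i (finv cw x) =
    \sum_(x | r x && ~~ r (opp x)) level l i x + #|[set x | r x && ~~ r (opp x)]|.
  by lia.
rewrite (reindex_inj (@opp_inj G)) -sum1dep_card -big_split /=.
apply: eq_big => [x|x rx]; first by rewrite oppK.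
by rewrite -[finv cw (opp x)]/(next_corner x) boundary_next ?addn1 //
  -{1}[x]oppK.
Qed.

Lemma sum_jump_inside :
  2 * \sum_(x | r x && r (opp x)) jump l x =
  #|[set x | r x && r (opp x)]| * n.+1.
Proof.
rewrite -sum_nat_const mul2n -addnn.
rewrite [X in _ + X](reindex_inj (@opp_inj G)).
rewrite [X in _ + X](eq_bigl (fun x => r x && r (opp x))); last first.
  by move=> x; rewrite oppK andbC.
rewrite -big_split; apply: eq_big => x; first by rewrite inE.
by move=> /r_inner /(jump_opp hG hu hl).
Qed.

Let inside := #|[set x | r x && r (opp x)]|.
Let colored_inside := #|[set x | [&& r x, r (opp x) & colored l i x]]|.

(** Let I, c, b and f count arcs inside, colored arcs inside, boundary arcs and faces inside. Then
    I(d - 2) = 2b + 2cd by summing [jump_level], and I + b = fd by counting corners; eliminating b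
    and dividing by d gives the claim. *)
Lemma card_inside : inside = 2 * colored_inside + 2 * #|~: S|.
Proof.
have corners : inside + #|[set x | r x && ~~ r (opp x)]| = #|~: S| * n.+3.
  rewrite -sum_nat_const.
  rewrite (eq_bigr (fun f => \sum_(x | r x && (rface x == f)) 1)); last first.
    move=> f; rewrite in_setC => fS; rewrite -(hG f) sum1dep_card.
    apply: eq_card => x; rewrite !inE andbC.
    by case: eqP => // xf; rewrite /r xf fS.
  rewrite -(partition_big (@rface G)) => [|x]; last by rewrite in_setC.
  by rewrite (bigID (fun x => r (opp x))) /= !sum1dep_card.
have : \sum_(x | r x && r (opp x)) (jump l x + level l i (finv cw x)) =
  \sum_(x | r x && r (opp x)) (level l i x + colored l i x * n.+3).
  by apply: eq_bigr => x _; exact: jump_level.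
rewrite !big_split /= sum_level_inside -big_distrl /=.
have -> : \sum_(x | r x && r (opp x)) colored l i x = colored_inside.
  rewrite /colored_inside -sum1dep_card.
  under [RHS]eq_bigl do rewrite andbA.
  by rewrite [RHS]big_mkcondr.
have := sum_jump_inside; rewrite -/inside; nia.
Qed.

Lemma card_symmetrized (q : pred (dart G)) : (forall x, q (opp x) = q x) ->
  #|[set x | C x && q x]| = 2 * #|[set x in X | q x]|.
Proof.
move=> q_opp; set Q := [set x in X | q x].
have -> : [set x | C x && q x] = Q :|: opp @: Q.
  apply/setP => x; rewrite !inE andb_orl; congr (_ || _).
  apply/idP/imsetP => [xQ|[y + ->]]; first by exists (opp x); rewrite ?inE ?q_opp ?oppK.
  by rewrite inE oppK q_opp.
rewrite cardsU card_imset; last exact: opp_inj.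
rewrite (_ : _ :&: _ = set0) ?cards0 ?subn0 ?mul2n ?addnn //.
apply/setP => x; rewrite !inE; apply/negbTE/negP => /andP[/andP[xX _]].
case/imsetP => y; rewrite inE => /andP[/opp_notin/negP yX _] xy.
by apply: yX; rewrite -xy.
Qed.

(** The external side gives 2|N| + 2|S| <= |D| + 2 and the other side 2|M| + 2|~S| <= |E|. The
    remaining vertices number at most |X|, so 2|V| + 2|F| is at most the number of darts plus 2,
    against plus 4 in Euler's relation. *)
Lemma trap_empty : X = set0.
Proof.
apply/eqP/set0Pn => -[x0 Xx0].
have Cx0 : C x0 by rewrite /C Xx0.
have := ext_component_bound C_opp Cx0.
set N := [set v | _]; set D := [set x | _] => bound.
pose M := [set v | [forall (x | origin x == v), ~~ C x && r x]].
pose E := [set x | ~~ C x && r x].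
have card_vertices : #|vertex G| <= #|N| + #|M| + #|X|.
  apply: leq_trans (leq_add (leqnn _) (leq_imset_card (@origin G) X)).
  apply: leq_trans (leq_add (leq_card_setU N M) (leqnn _)).
  apply: leq_trans (leq_card_setU _ _).
  rewrite -cardsT subset_leq_card //; apply/subsetP => v _.
  rewrite !in_setU; case: (boolP (v \in origin @: X)) => [|vX]; rewrite ?orbT //.
  rewrite orbF.
  (* By [Xout] the head of an arc of [X] is also an origin, so a vertex touching the cut lies in
     [origin @: X]. *)
  have CF x : origin x = v -> ~~ C x.
    move=> xv; apply/negP => /orP[xX|/[dup] oxX /Xout[y yX yo]].
      by move/negP: vX; apply; rewrite -xv imset_f.
    move/negP: vX; apply; rewrite -xv; move: yo; rewrite /target oppK => <-.
    exact: imset_f.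
  have [x xv] := origin_surj v.
  have rE y : origin y = v -> r y = r x.
    move=> yv; apply: (@origin_ind _ (fun y => r y = r x) x) => [z||]; rewrite ?xv //.
    move=> zv <-; rewrite -r_opp ?CF ?origin_cw // -r_pred cwK //.
  case: (boolP (r x)) => rx; apply/orP; [right|left]; rewrite in_set;
    apply/forall_inP => y /eqP yv; rewrite CF //=.
    by rewrite rE.
  by have := rE y yv; rewrite /r => /negbRL; rewrite -/(r x) rx.
have card_split : #|dart G| = #|D| + #|E| + 2 * #|X|.
  have -> : 2 * #|X| = #|[set x | C x]|.
    have := card_symmetrized (q := predT) (fun=> erefl).
    rewrite (_ : [set x in X | _] = X) => [<-|]; last first.
      by apply/setP => x; rewrite !inE andbT.
    by apply: eq_card => x; rewrite !inE andbT.
  rewrite -(cardsC [set x | C x]) addnC; congr (_ + _).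
  rewrite -(cardsID [set x | rface x \in S]); congr (_ + _);
  by apply: eq_card => x; rewrite !inE /r ?inE // andbC.
have card_split_inside : inside = #|E| + 2 * #|[set x in X | r x && r (opp x)]|.
  rewrite -card_symmetrized => [|x]; last by rewrite oppK andbC.
  rewrite addnC /inside -(cardsID [set x | C x]); congr (_ + _);
  apply: eq_card => x; rewrite !in_set; first by rewrite andbC.
  by case: (boolP (C x)) => //= /r_opp ->; rewrite andbb.
(* Each vertex of [M] has its own outgoing colored arc, which lies inside and outside [X]. *)
have card_M : #|M| + #|[set x in X | r x && r (opp x)]| <= colored_inside.
  pose Y := [set x | [&& r x, r (opp x) & colored l i x]].
  rewrite -[colored_inside](cardsID X Y) addnC leq_add //.
    apply/subset_leq_card/subsetP => x; rewrite in_set => /andP[xX rx].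
    by rewrite in_setI xX in_set andbA rx Xi.
  apply: leq_trans (leq_imset_card (@origin G) _); apply/subset_leq_card/subsetP.
  move=> v; rewrite in_set => /forall_inP Mv.
  have [|x /(_ x)] := @colored_out i v.
    by apply/existsP => -[x /andP[/Mv/andP[_ /r_ext/negP xf] /xf]].
  rewrite eqxx => /andP[/eqP xv xi]; apply/imsetP; exists x => //.
  have /andP[Cx rx] : ~~ C x && r x by apply: Mv; rewrite xv.
  rewrite !in_set xi r_opp // rx !andbT /=.
  by move: Cx; rewrite negb_or => /andP[].
have := card_inside; have := euler_darts G.
have := card_dart_faces hG; have := cardsC S; lia.
Qed.

End Trap.
End NoTrap.

(** * From labellings to Schnyder decompositions *)

Lemma val_natZ n k : k < n.+3 -> (k%:R : 'I_n.+3)%R = k :> nat.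
Proof. by move=> ?; rewrite Zp_nat /= modn_small. Qed.

Lemma iter_ordS n k (c : 'I_n.+3) : iter k (@ordS _) c = (c + k%:R)%R.
Proof.
elim: k => [|k IHk]; first by rewrite addr0.
by rewrite iterS IHk ordSE mulrSr addrA.
Qed.

(** * Positions in a clockwise turn *)

Section TurnOrder.

Variable G : plane_graph.
Implicit Types (a x y z : dart G).

Lemma findex_pred a x : origin x = origin a -> x != a ->
  findex cw a x = (findex cw a (finv cw x)).+1.
Proof.
move=> /esym/eqP; rewrite originP => ax xa.
have lt := findex_max ax; have ix := iter_findex ax.
case: (findex cw a x) lt ix => [_ /= ax'|k lt ix]; first by rewrite ax' eqxx in xa.
by rewrite -ix iterS cwK findex_iter // ltnW.
Qed.

Lemma findex_mono (g : dart G -> nat) a x y :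
  (forall z, origin z = origin a -> cw z != a -> g z <= g (cw z)) ->
  origin x = origin a -> origin y = origin a ->
  findex cw a x <= findex cw a y -> g x <= g y.
Proof.
move=> g_mono /esym/eqP + /esym/eqP; rewrite !originP => ax ay.
rewrite -{2}(iter_findex ax) -{2}(iter_findex ay).
move: (findex_max ay); elim: (findex cw a y) => [|m IHm] lt.
  by rewrite leqn0 => /eqP ->.
rewrite leq_eqVlt => /orP[/eqP -> //|/(IHm (ltnW lt))/leq_trans]; apply.
have origin_iter k : origin (iter k cw a) = origin a.
  by elim: k => //= k; rewrite origin_cw.
apply: g_mono => //; rewrite -iterS; apply: contra_eq_neq (findex_iter lt) => ->.
by rewrite findex0.
Qed.

Lemma findex_lt (g : dart G -> nat) a x y :
  (forall z, origin z = origin a -> cw z != a -> g z <= g (cw z)) ->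
  origin x = origin a -> origin y = origin a ->
  g x < g y -> findex cw a x < findex cw a y.
Proof. by move=> g_mono xa ya; rewrite !ltnNge; apply/contra/findex_mono. Qed.

End TurnOrder.

(** Levels drop only at the colored arc [a]. The turn starts just after [a], so the value d puts [a]
    itself last. *)
Lemma level_monotone n (G : plane_graph) (h : dart G -> 'I_n.+3) i (a : dart G) :
  (forall z, origin z = origin a -> colored h i z = (z == a)) ->
  forall z, origin z = origin (cw a) -> cw z != cw a ->
    (if z == a then n.+3 else level h i z) <=
    (if cw z == a then n.+3 else level h i (cw z)).
Proof.
move=> only_a z; rewrite origin_cw (inj_eq (@cw_inj G)) => za za'.
rewrite (negPf za'); case: eqP => [_|/eqP cza]; first exact/ltnW/level_lt.
have := only_a (cw z); rewrite origin_cw (negPf cza) => /(_ za).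
by rewrite coloredE cwK; case: ltnP.
Qed.

Section SchnyderOfLabelling.

Variables (n : nat) (G : plane_graph) (u : 'I_n.+3 -> vertex G).
Hypotheses (hG : d_angulation n.+3 G) (hu : external_contour u).
Variable l : {ffun dart G -> 'I_n.+3}.
Hypothesis hl : clockwise_labelling u l.
Implicit Types (x y : dart G) (v : vertex G) (f : face G) (i j : 'I_n.+3).

Definition color_classes (h : dart G -> 'I_n.+3) : {ffun 'I_n.+3 -> {set dart G}} :=
  [ffun i => [set x | colored h i x]].

Lemma in_color_classes (h : dart G -> 'I_n.+3) i x :
  (x \in color_classes h i) = colored h i x.
Proof. by rewrite ffunE inE. Qed.

Lemma in_underlying (h : dart G -> 'I_n.+3) i x :
  (x \in underlying (color_classes h i)) = colored h i x || colored h i (opp x).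
Proof. by rewrite inE !in_color_classes. Qed.

Lemma level_shift c k x : level l (c + k)%R x =
  if k <= level l c x then level l c x - k else level l c x + n.+3 - k.
Proof. by rewrite /level opprD addrA; exact: val_subZ. Qed.

(** Without a wrap relative to [c], the arc passes c + k exactly for k above the level before it and
    up to the level after it. *)
Lemma colored_shift c k x : ~~ colored l c x -> colored l (c + k)%R x ->
  level l c (finv cw x) < k <= level l c x.
Proof.
rewrite !coloredE !level_shift.
have := level_lt l c x; have := level_lt l c (finv cw x); have := ltn_ord k.
by repeat case: ifP; lia.
Qed.

Lemma colored_shift_first c k x : l (finv cw x) = c -> colored l (c + k)%R x ->
  k <= level l c x.
Proof.
move=> xc; rewrite coloredE !level_shift.
have -> : level l c (finv cw x) = n.+2.
  rewrite /level xc !val_subZ !val_oneZ; have := ltn_ord c.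
  by repeat case: ifP; lia.
have := level_lt l c x; have := ltn_ord k.
by repeat case: ifP; lia.
Qed.

Lemma colored_origin i x : colored l i x -> inner_vertex (origin x).
Proof. by apply: contraTT => /(jump_ext hG hu hl); rewrite /colored => ->. Qed.

Lemma colored_uniq i x y :
  colored l i x -> colored l i y -> origin x = origin y -> x = y.
Proof.
move=> xi yi xy; have [z zP] := colored_out hG hu hl i (colored_origin xi).
have := zP x; rewrite xi eqxx => /esym/eqP ->.
by have := zP y; rewrite yi xy eqxx => /esym/eqP ->.
Qed.

(** At [u i] the level of [opp x] would be d - 1, with no room for the increase in [colored_pred];
    at [u (ordS i)] the next corner would have level 0, against [colored_next]. *)
Lemma colored_target i x : colored l i x ->
  (target x != u i) && (target x != u (ordS i)).
Proof.
move=> xi; have := colored_next hG hu hl xi; have := colored_pred hG hu hl xi.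
have := level_lt l i (finv cw x).
rewrite ordSE -negb_or => lt Epred Enext; apply/negP => /orP[] /eqP xt.
  have lo : l (opp x) = i by apply: (label_ext hl).
  move: Epred; rewrite {2}/level lo addrAC subrr sub0r => Epred.
  by move: lt; rewrite Epred -[(- 1)%R]sub0r val_subZ val_oneZ /=; lia.
have ln : l (next_corner x) = (i + 1)%R by apply: (label_ext hl); rewrite origin_next.
by move: Enext; rewrite {1}/level ln addrK subrr.
Qed.

(** A cycle has as many edges as vertices and each vertex is the origin of at most one arc of color
    i. Hence every vertex of the cycle is the origin of one of its colored arcs, and these form a
    trap. *)
Lemma color_class_acyclic i : acyclic (color_classes l i).
Proof.
move=> p pu cp uo ue.
pose X := [set x | colored l i x && ((x \in p) || (opp x \in p))].
have step x : x \in p -> exists2 y, y \in p & target x = origin y.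
  move=> px; exists (next p x); first by rewrite mem_next.
  by have /eqP := next_cycle cp px.
have in_p y : y \in p -> exists2 x, x \in X & edge x = edge y.
  move=> py; have : y \in underlying _ := allP pu y py.
  rewrite in_underlying => /orP[yi|yi].
    by exists y => //; rewrite inE yi py.
  by exists (opp y); rewrite ?edge_opp // inE yi oppK py orbT.
have Xp x : x \in X -> origin x \in map origin p /\ target x \in map origin p.
  rewrite inE => /andP[_ /orP[px|px]]; have [y py yx] := step _ px.
    by split; [exact: map_f|rewrite yx map_f].
  by split; [move: yx; rewrite /target oppK => ->; exact: map_f|
             exact: map_f px].
have Xinj : {in X &, injective origin}.
  move=> x y; rewrite !inE => /andP[xi _] /andP[yi _].
  exact: colored_uniq xi yi.
have cardX : size p <= #|X|.
  rewrite -(size_map (@edge G)) -(card_uniqP ue).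
  apply: leq_trans (leq_imset_card (@edge G) X); apply/subset_leq_card/subsetP.
  by move=> _ /mapP[y /in_p[x Xx <-] ->]; exact: imset_f.
have eqX : origin @: X = [set v in map origin p].
  apply/eqP; rewrite eqEcard; apply/andP; split.
    by apply/subsetP => _ /imsetP[x /Xp[xp _] ->]; rewrite inE.
  by rewrite cardsE (card_uniqP uo) size_map (card_in_imset Xinj).
have X0 : X = set0.
  apply: (@trap_empty n G u hG hu l hl i X) => x.
    by rewrite inE => /andP[].
  move=> /Xp[_]; rewrite -[_ \in _]/(target x \in mem (map origin p)).
  have -> : (target x \in mem (map origin p)) = (target x \in origin @: X).
    by rewrite eqX inE.
  by move=> /imsetP[y Xy ->]; exists y.
case def_p: p => [//|y p'].
have py : y \in p by rewrite def_p mem_head.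
by have [x] := in_p y py; rewrite X0 inE.
Qed.

(** The arcs from whose origins no external vertex is reached form a trap: their targets are inner,
    so the path continues. *)
Lemma reach_root i v : exists j, connect (adjacent (color_classes l i)) v (u j).
Proof.
pose bad v := [forall j, ~~ connect (adjacent (color_classes l i)) v (u j)].
have step x : colored l i x ->
    connect (adjacent (color_classes l i)) (origin x) (target x).
  by move=> xi; apply/connect1/exists_inP; exists x; rewrite ?in_color_classes ?eqxx.
have out y : inner_vertex (origin y) ->
    exists2 x, colored l i x & origin x = origin y.
  move=> /(colored_out hG hu hl i)[x /(_ x)].
  by rewrite eqxx => /andP[/eqP xv xi]; exists x.
have X0 : [set x | colored l i x && bad (origin x)] = set0.
  apply: (@trap_empty n G u hG hu l hl i) => x; rewrite inE => /andP[xi] //.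
  move=> /forallP badx; have bad_t : bad (target x).
    apply/forallP => j; apply: contra (badx j); exact: connect_trans (step x xi).
  have [y yi yo] : exists2 y, colored l i y & origin y = target x.
    apply: (out (opp x)); apply/negP => /(ext_vertexP hG hu)[j xj].
    by move/forallP/(_ j): bad_t; rewrite -[target x]/(origin (opp x)) xj connect0.
  by exists y; rewrite // inE yi yo.
have [/(ext_vertexP hG hu)[j ->]|] := boolP (ext_vertex v).
  by exists j; exact: connect0.
have [y <-] := origin_surj v; move=> /out[x xi <-].
have /setP/(_ x) := X0; rewrite !inE xi /= => /negbT/forallPn[j]; rewrite negbK.
by exists j.
Qed.

Lemma color_class_rooted i :
  rooted_spanning u (~: [set u i; u (ordS i)]) (~: [set i; ordS i])
    (color_classes l i).
Proof.
set W := ~: _; set A := color_classes l i.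
have ext_notin x j : origin x = u j -> ~~ colored l i x.
  by apply: contra_eqN => /colored_origin; apply: contraTneq => ->;
    rewrite (inner_vertex_ext hG hu).
have AW x : x \in A -> (origin x \in W) && (target x \in W).
  rewrite in_color_classes => xi; rewrite !inE !negb_or (colored_target xi) andbT.
  by apply/andP; split; apply: contraL xi => /eqP; exact: ext_notin.
split=> // v vW; have [j vj] := reach_root i v.
have adj_out a b b' : adjacent A a b -> adjacent A a b' -> b = b'.
  move=> /exists_inP[x + /andP[/eqP xa /eqP <-]].
  move=> + /exists_inP[y + /andP[/eqP ya /eqP <-]].
  rewrite !in_color_classes => xi yi.
  by rewrite (colored_uniq xi yi) // xa ya.
have root_stop k b : ~~ adjacent A (u k) b.
  apply/exists_inP => -[x xA /andP[/eqP xk _]].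
  by move: xA; rewrite in_color_classes => /(negP (ext_notin _ _ xk)).
have reach_step k a b : adjacent A a b -> connect (adjacent A) a (u k) ->
    connect (adjacent A) b (u k).
  move=> ab /connectP[[/= _ ak|c p /= /andP[ac pth] lst]].
    by have := root_stop k b; rewrite ak ab.
  by apply/connectP; exists p; rewrite (adj_out _ _ _ ab ac).
have reach_all k a b : connect (adjacent A) a b -> connect (adjacent A) a (u k) ->
    connect (adjacent A) b (u k).
  move=> /connectP[p]; elim: p a => [|c p IHp] a /=; first by move=> _ ->.
  by move=> /andP[ac pth] lst /(reach_step _ _ _ ac); exact: IHp.
(* An edge followed backwards does no harm: its arc is the only one leaving its origin, so the path
   to the root starts with it. *)
have reach_und k a : connect (adjacent (underlying A)) a (u k) ->
    connect (adjacent A) a (u k).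
  move=> /connectP[p]; elim: p a => [|b p IHp] a /=; first by move=> _ ->.
  move=> /andP[/exists_inP[x xA /andP[/eqP xa /eqP xb]] pth lst].
  have bk := IHp b pth lst; move: xA; rewrite inE => /orP[xA|xA].
    apply: connect_trans bk; apply: connect1; apply/exists_inP.
    by exists x; rewrite ?xa ?xb ?eqxx.
  apply: reach_step bk; apply/exists_inP; exists (opp x) => //.
  by rewrite /target oppK xa -xb !eqxx.
exists j; split=> // [|k _ /reach_und vk]; last first.
  have /connectP[[|b p] /=] := reach_all _ _ _ vj vk.
    by move=> _ /(u_inj hu).
  by rewrite (negPf (root_stop _ _)).
have jW : u j \in W.
  case/connectP: vj => p pth ->.
  elim: p v vW pth => //= b p IHp v vW /andP[/exists_inP[x /AW + /andP[_ /eqP <-]]].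
  by move=> /andP[_ xW] /(IHp _ xW).
move: jW; rewrite !inE; apply: contra => /orP[] /eqP ->; by rewrite eqxx ?orbT.
Qed.

Lemma color_classes_clockwise v (e : 'I_n.+3 -> dart G) :
  (forall i x, (origin x == v) && (x \in color_classes l i) = (x == e i)) ->
  clockwise_around e.
Proof.
move=> eP.
have ev i : origin (e i) = v by have := eP i (e i); rewrite eqxx => /andP[/eqP].
have ec i : colored l i (e i).
  by have := eP i (e i); rewrite eqxx in_color_classes => /andP[].
have eE i x : origin x = v -> colored l i x = (x == e i).
  by move=> xv; rewrite -eP xv eqxx in_color_classes.
(* The turn starts at an outgoing arc, and [c] is the label just before it, the first color that
   this arc passes; hence [e c = x0]. *)
pose x0 := e ord0; pose c := l (finv cw x0).
have x0c : e c = x0.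
  apply/esym/eqP; rewrite -eE ?ev // /colored /level /jump -/c.
  have := ec ord0; rewrite /colored /jump -/x0 -/c [(_ - 1 - _)%R]addrAC.
  move: (l x0 - c)%R => k; have := val_subZ k 1%R; rewrite val_oneZ => ->.
  by case: ifP; lia.
exists c; apply/(sortedP 0) => j; rewrite size_map size_iota => jd.
rewrite !(nth_map 0) ?size_iota // ?(ltnW jd) // !nth_iota // ?(ltnW jd) //.
rewrite !add0n !iter_ordS.
set w := e (c + j%:R)%R; set w' := e (c + j.+1%:R)%R.
have [->|wc] := eqVneq w (e c); first by rewrite findex0.
rewrite findex_pred ?ev // -/w; apply: (@findex_lt _ (level l c)).
- move=> z zv zc; have := eE c (cw z); rewrite origin_cw zv ev (negPf zc).
  by move=> /(_ erefl); rewrite coloredE cwK; case: ltnP.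
- by rewrite origin_pred !ev.
- by rewrite !ev.
have : level l c (finv cw w) < (j%:R : 'I_n.+3)%R <= level l c w.
  by apply: colored_shift; rewrite ?ec // eE ?ev.
rewrite val_natZ ?(ltnW jd) // => /andP[lt _]; apply: (leq_trans lt).
suff : (j.+1%:R : 'I_n.+3)%R <= level l c w' by rewrite val_natZ // => /ltnW.
have [w'c|w'c] := eqVneq w' (e c).
  by apply: colored_shift_first; rewrite ?ec // w'c x0c.
by have /andP[] : level l c (finv cw w') < (j.+1%:R : 'I_n.+3)%R <= level l c w'
  by apply: colored_shift; rewrite ?ec // eE ?ev.
Qed.

(** Turning from [e (i + 1)], the level relative to i + 1 is at most d - 3 at the incoming arc, but
    at least d - 2 at [e (i - 1)] unless the latter is the final arc [a]. *)
Lemma color_classes_between v (e : 'I_n.+3 -> dart G) i x :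
  (forall i x, (origin x == v) && (x \in color_classes l i) = (x == e i)) ->
  origin x = v -> opp x \in color_classes l i ->
  strictly_between (e (ordS i)) (e (ord_pred i)) x.
Proof.
move=> eP xv; rewrite in_color_classes => xi.
have ev k : origin (e k) = v by have := eP k (e k); rewrite eqxx => /andP[/eqP].
have ec k : colored l k (e k).
  by have := eP k (e k); rewrite eqxx in_color_classes => /andP[].
have eE k z : origin z = v -> colored l k z = (z == e k).
  by move=> zv; rewrite -eP zv eqxx in_color_classes.
rewrite /strictly_between ordSE ord_predE; set a := e (i + 1)%R; set b := e _.
pose g z := if z == a then n.+3 else level l (i + 1)%R z.
have := colored_next hG hu hl xi; have := colored_pred hG hu hl xi.
have := level_gap hG hu hl xi; have := level_lt l i (finv cw (opp x)).
rewrite /next_corner oppK => lt gap Epred Enext.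
have xa : ~~ colored l (i + 1)%R x.
  rewrite coloredE !level_shift val_oneZ; repeat case: ifP; lia.
apply: (@findex_lt _ g).
- by apply: level_monotone => z; rewrite ev; exact: eE.
- by rewrite origin_cw xv ev.
- by rewrite origin_cw !ev.
rewrite /g -eE // (negPf xa).
have gx : level l (i + 1)%R x < n.+1.
  rewrite level_shift val_oneZ; case: ifP; lia.
have [_|ba] := eqVneq b a; first by apply: ltn_trans gx _.
suff /andP[_] : level l (i + 1)%R (finv cw b) < (- 1 - 1 : 'I_n.+3)%R <=
    level l (i + 1)%R b.
  apply: leq_trans; apply: leq_trans gx _.
  by rewrite val_subZ -[(- 1)%R]sub0r val_subZ val_oneZ.
apply: colored_shift; first by rewrite eE ?ev.
by rewrite addrA addrK ec.
Qed.

Lemma schnyder_of_labelling : schnyder_decomposition u (color_classes l).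
Proof.
split=> [i|x xi|i|v vi].
- split=> [|x]; last by rewrite in_color_classes => /(colored_inner hG hu hl).
  split; last exact: color_class_acyclic.
  by move=> x; rewrite !in_color_classes => /(colored_opp hG hu hl).
- rewrite subSS subn1 /=; apply: etrans (jump_opp hG hu hl xi).
  rewrite -!card_colored.
  rewrite -cardsUI [X in _ + X](_ : _ = 0) ?addn0; last first.
    apply/eqP; rewrite cards_eq0; apply/eqP/setP => i; rewrite !inE.
    by apply/negbTE/negP => /andP[/(colored_opp hG hu hl)/negP].
  by apply: eq_card => i; rewrite !inE !in_color_classes.
- exact: color_class_rooted.
have /fin_all_exists[e eP] i := colored_out hG hu hl i vi.
have eP' i x : (origin x == v) && (x \in color_classes l i) = (x == e i).
  by rewrite in_color_classes.
exists e; split=> // [|i x]; first exact: color_classes_clockwise eP'.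
exact: color_classes_between.
Qed.

End SchnyderOfLabelling.

(** * From Schnyder decompositions to labellings *)

(** Sublevel sets of a monotone function are initial segments. *)
Lemma ltn_card_sublevel m (q : 'I_m -> nat) p (j : 'I_m) :
  {homo q : i k / i <= k} -> (j < #|[set i | q i <= p]|) = (q j <= p).
Proof.
move=> q_mono; apply/idP/idP => [|qj].
  apply: contraTT; rewrite -!ltnNge ltnS => pq.
  rewrite -[X in _ <= X](card_ord_lt (ltnW (ltn_ord j))).
  apply/subset_leq_card/subsetP => i.
  by rewrite !inE !ltnNge; apply: contraL => /q_mono/(leq_trans pq); rewrite ltnNge.
rewrite -[X in X <= _](card_ord_lt (ltn_ord j)); apply/subset_leq_card/subsetP => i.
by rewrite !inE => /q_mono/leq_trans; apply.
Qed.

Lemma findex_last (G : plane_graph) (a y : dart G) : origin y = origin a ->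
  findex cw a y <= findex cw a (finv cw a).
Proof.
move=> /esym/eqP; rewrite originP => /findex_max lt.
have a_gt0 : 0 < order cw a by apply: leq_ltn_trans lt.
rewrite /finv.
by rewrite findex_iter ?prednK // -ltnS prednK.
Qed.

Section LabellingOfSchnyder.

Variables (n : nat) (G : plane_graph) (u : 'I_n.+3 -> vertex G).
Hypotheses (hG : d_angulation n.+3 G) (hu : external_contour u).
Variable F : {ffun 'I_n.+3 -> {set dart G}}.
Hypothesis hF : schnyder_decomposition u F.
Implicit Types (x y : dart G) (v : vertex G) (f : face G) (i j : 'I_n.+3).

Definition multiplicity x := #|[set i | x \in F i]|.

Lemma decomposition_inner i x : x \in F i -> inner_dart x.
Proof. by case: hF => /(_ i)[_ +] _ _ _; apply. Qed.

Lemma multiplicity_opp x : inner_dart x ->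
  multiplicity x + multiplicity (opp x) = n.+1.
Proof.
case: hF => F1 F2 _ _ /F2; rewrite subSS subn1 /= => <-.
rewrite /multiplicity -cardsUI [X in _ + X](_ : _ = 0) ?addn0; last first.
  apply/eqP; rewrite cards_eq0; apply/eqP/setP => i; rewrite !inE.
  by apply/negbTE/negP => /andP[xi]; have [[/(_ x xi)/negP]] := F1 i.
by apply: eq_card => i; rewrite !inE.
Qed.

Lemma decomposition_out i v : inner_vertex v ->
  #|[set x | (origin x == v) && (x \in F i)]| = 1.
Proof.
case: hF => _ _ _ /[apply] -[e [eP _ _]].
by rewrite (_ : [set x | _] = [set e i]) ?cards1 //; apply/setP => x; rewrite !inE eP.
Qed.

Lemma sum_multiplicity v : inner_vertex v ->
  \sum_(x | origin x == v) multiplicity x = n.+3.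
Proof.
move=> vi; rewrite -[RHS]card_ord -sum1_card.
under eq_bigr => x _ do rewrite /multiplicity -sum1dep_card big_mkcond.
rewrite exchange_big; apply: eq_bigr => i _.
by rewrite -[RHS](decomposition_out i vi) -[RHS]sum1dep_card [RHS]big_mkcondr.
Qed.

(* By Euler's relation, the outdegrees of the inner vertices already account
   for all arcs. *)
Lemma decomposition_origin i x : x \in F i -> inner_vertex (origin x).
Proof.
have inner0 : \sum_(x in [set x : dart G | inner_dart x]) multiplicity x =
    \sum_x multiplicity x.
  rewrite big_mkcond; apply: eq_bigr => y _; rewrite inE; case: ifPn => // yi.
  apply/esym/eqP; rewrite cards_eq0; apply/set0Pn => -[k].
  by rewrite inE => /decomposition_inner; apply/negP.
have : \sum_(x in [set x : dart G | inner_dart x])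
         (multiplicity x + multiplicity (opp x)) =
       #|[set x : dart G | inner_dart x]| * n.+1.
  by rewrite -sum_nat_const; apply: eq_bigr => y; rewrite inE => /multiplicity_opp.
rewrite -(euler_inner hG hu) big_split /= sum_opp addnn -mul2n => /eqP.
rewrite eqn_pmul2l // inner0 (bigID (fun y => inner_vertex (origin y))) /=.
rewrite (partition_big (@origin G) (mem [set v : vertex G | inner_vertex v])) /=;
  last by move=> y; rewrite inE.
rewrite (eq_bigr (fun=> n.+3)) => [|v]; last first.
  rewrite inE => vi; rewrite -(sum_multiplicity vi); apply: eq_bigl => y.
  by rewrite andbC; case: eqP => // ->.
rewrite sum_nat_const -{2}[_ * _]addn0 eqn_add2l sum_nat_eq0 => /forall_inP ext0.
move=> xi; apply: contraT => xv; have := ext0 x xv.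
by rewrite cards_eq0 => /eqP/setP/(_ i); rewrite !inE xi.
Qed.

Lemma multiplicity_le x : multiplicity x <= n.+1.
Proof.
have [/multiplicity_opp <-|xi] := boolP (inner_dart x); first exact: leq_addr.
rewrite /multiplicity (_ : [set i | _] = set0) ?cards0 //.
by apply/setP => i; rewrite !inE; apply/negbTE/negP => /decomposition_inner; apply/negP.
Qed.

Lemma local_labelling v : inner_vertex v -> exists h : dart G -> 'I_n.+3,
  forall x, origin x = v -> forall i, (x \in F i) = colored h i x.
Proof.
case: hF => _ _ _ /[apply] -[e [eP [c c_sorted] _]].
have ev i : origin (e i) = v by have := eP i (e i); rewrite eqxx => /andP[/eqP].
have eE i x : origin x = v -> (x \in F i) = (x == e i).
  by move=> xv; rewrite -eP xv eqxx.
pose pos x := findex cw (e c) x.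
pose q j := pos (e (c + j)%R).
have pos_inj x y : origin x = v -> origin y = v -> (pos x == pos y) = (x == y).
  rewrite -(ev c) => /esym/eqP + /esym/eqP; rewrite !originP => cx cy.
  apply/eqP/eqP => [eq_pos|-> //].
  by rewrite -(iter_findex cx) -/(pos x) eq_pos iter_findex.
have q_mono : {homo q : i k / i <= k}.
  move=> i k ik; have := sorted_leq_nth leq_trans leqnn 0 c_sorted.
  move=> /(_ i k); rewrite !inE size_map size_iota !ltn_ord => /(_ erefl erefl ik).
  by rewrite !(nth_map 0) ?size_iota // !nth_iota // !add0n !iter_ordS !natr_Zp.
(* The number of colors met up to position p, so that [h x] is the next outgoing color after [x]. *)
pose N p := #|[set j | q j <= p]|.
have N_le p : N p <= n.+3 by rewrite -[X in _ <= X]card_ord max_card.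
pose h x : 'I_n.+3 := (c + (N (pos x))%:R)%R.
exists h => x xv i.
(* Colors met strictly before [x]. At [e c] the count restarts: the full turn gives d, which is 0
   modulo d. *)
pose lo := if x == e c then 0 else N (pos (finv cw x)).
have h_pred : h (finv cw x) = (c + lo%:R)%R.
  rewrite /h /lo; case: eqP => // ->; congr (_ + _)%R.
  have -> : N (pos (finv cw (e c))) = n.+3.
    rewrite -[RHS]card_ord -cardsT; apply: eq_card => j; rewrite !inE.
    by apply: findex_last; rewrite !ev.
  by apply: val_inj; rewrite Zp_nat /= modnn.
have Fx j : (x \in F (c + j)%R) = (lo <= j < N (pos x)).
  rewrite eE // -pos_inj ?ev // -/(q j) /lo ltn_card_sublevel //.
  have [->|xc] := eqVneq x (e c); first by rewrite /pos findex0 eq_sym leqn0.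
  rewrite leqNgt ltn_card_sublevel // -ltnNge.
  by rewrite {1 3}/pos findex_pred ?xv ?ev // eqn_leq andbC.
(* At most d - 2 colors share an arc. This excludes an arc carrying all colors, whose jump modulo d
   would be 0. *)
have [j0 xj0] : exists j, ~~ (lo <= j < N (pos x)).
  apply/existsP; rewrite -negb_forall; apply/forallP => all_j.
  have := multiplicity_le x; rewrite /multiplicity (_ : [set i | _] = setT).
    by rewrite cardsT card_ord; lia.
  by apply/setP => k; rewrite !inE -[k](subrK c) addrC Fx all_j.
have lo_le : lo <= N (pos x).
  rewrite /lo; case: eqVneq => // xc; apply/subset_leq_card/subsetP => j.
  by rewrite !inE {2}/pos findex_pred ?xv ?ev //; exact: leqW.
rewrite -[i](subrK c) addrC Fx.
move: (i - c)%R => j; rewrite /colored /level /jump h_pred {1 2}/h.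
have -> : (c + (N (pos x))%:R - 1 - (c + j) = (N (pos x))%:R - 1 - j :> 'I_n.+3)%R.
  by ring.
have -> : (c + (N (pos x))%:R - (c + lo%:R) = (N (pos x))%:R - lo%:R :> 'I_n.+3)%R.
  by ring.
have lo_le' := leq_trans lo_le (N_le (pos x)).
have val_nat k : k <= n.+3 ->
    (k%:R : 'I_n.+3)%R = (if k == n.+3 then 0 else k) :> nat.
  rewrite Zp_nat /=; case: eqP => [->|*]; first by rewrite modnn.
  by rewrite modn_small //; lia.
rewrite !val_subZ !val_nat // val_oneZ.
have := N_le (pos x); have := ltn_ord j; have := ltn_ord j0; move: xj0 lo_le.
by repeat case: ifP; lia.
Qed.

(** * The face rule for labels given by outgoing colors *)

Section FaceRule.

Variable l : {ffun dart G -> 'I_n.+3}.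
Hypotheses (l_colored : forall i x, (x \in F i) = colored l i x)
  (l_ext : forall i x, origin x = u i -> l x = i).

Lemma multiplicity_jump x : multiplicity x = jump l x.
Proof. by rewrite -card_colored; apply: eq_card => i; rewrite !inE l_colored. Qed.

Lemma colored_jump_opp x : inner_dart x -> jump l x + jump l (opp x) = n.+1.
Proof. by move=> /multiplicity_opp; rewrite !multiplicity_jump. Qed.

(** The condition on incoming arcs places [opp x] before [e (i - 1)] in the turn from [e (i + 1)];
    the level just before that arc bounds the level at [opp x]. *)
Lemma colored_between x i : inner_vertex (target x) -> colored l i x ->
  ~~ colored l (i + 1)%R (opp x) && (level l (i + 1)%R (opp x) <= n).
Proof.
move=> xv xi; case: hF => _ _ _ /(_ _ xv) [e [eP _]].
move=> /(_ i (opp x) erefl); rewrite oppK l_colored => /(_ xi).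
have ev k : origin (e k) = target x by have := eP k (e k); rewrite eqxx => /andP[/eqP].
have eE k z : origin z = target x -> colored l k z = (z == e k).
  by move=> zv; rewrite -l_colored -eP zv eqxx.
rewrite /strictly_between ordSE ord_predE; set a := e (i + 1)%R; set b := e _.
pose g z := if z == a then n.+3 else level l (i + 1)%R z => xb.
have ba : b != cw a by apply: contraTneq xb => ->; rewrite findex0.
have : g (opp x) <= g (finv cw b).
  apply: (@findex_mono _ g (cw a)).
  - by apply: level_monotone => z; rewrite ev; exact: eE.
  - by rewrite origin_cw ev.
  - by rewrite origin_pred origin_cw !ev.
  by rewrite -ltnS -findex_pred ?origin_cw ?ev.
have b_pred : finv cw b != a by apply: contraNneq ba => <-; rewrite pred_cwK.
(* As the jump of [b] is at most d - 2, the level relative to i - 1 before [b] is at least 2; the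
   shift by 2 leaves at most d - 3. *)
have b_level : level l (i + 1)%R (finv cw b) <= n.
  have b_col : colored l (i - 1)%R b by rewrite eE ?ev.
  have -> : (i + 1 = i - 1 + (1 + 1) :> 'I_n.+3)%R by ring.
  rewrite level_shift (_ : (1 + 1 : 'I_n.+3)%R = 2 :> nat) ?val_addZ //.
  have := jump_level l (i - 1)%R b; rewrite b_col mul1n.
  have := multiplicity_le b; rewrite multiplicity_jump.
  have := level_lt l (i - 1)%R (finv cw b).
  by case: ifP; lia.
rewrite /g (negPf b_pred) eE ?[origin _]erefl // -/a.
by case: eqP => /= _; have := b_level; lia.
Qed.

Lemma next_label_colored x : inner_dart x -> 0 < jump l x ->
  l (next_corner x) = (l x + 1)%R.
Proof.
move=> xI x_gt0; have K := colored_jump_opp xI.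
have [/(ext_vertexP hG hu)[j xj]|xv] := boolP (ext_vertex (target x)).
  rewrite (@l_ext j) ?origin_next //.
  have ox0 : jump l (opp x) = 0.
    rewrite -multiplicity_jump; apply/eqP; rewrite cards_eq0; apply/set0Pn => -[i].
    rewrite inE => /decomposition_origin; rewrite -[origin _]/(target x) xj.
    by rewrite (inner_vertex_ext hG hu).
  (* The forests [F j] and [F (j - 1)] avoid [u j]. Since [x] carries all other colors, the two
     missing ones determine its label. *)
  have notin i : (j == i) || (j == ordS i) -> ~~ colored l i x.
    rewrite -l_colored; apply: contraL => /[dup] xi.
    case: hF => _ _ /(_ i)[/(_ x) + _] _ => /[apply] /andP[_].
    by rewrite !inE xj !(inj_eq (u_inj hu)).
  have := notin j; have := notin (j - 1)%R.
  rewrite ordSE subrK !eqxx orbT => /(_ erefl) + /(_ erefl).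
  rewrite /colored -!leqNgt; have -> : jump l x = n.+1 by lia.
  have := val_subZ (l x - 1)%R j; rewrite /level.
  have -> : (l x - 1 - (j - 1) = l x - j :> 'I_n.+3)%R by ring.
  rewrite !val_subZ !val_oneZ => _ le le'; apply: val_inj.
  rewrite [RHS]val_addZ val_oneZ; move: le le'.
  have := ltn_ord j; have := ltn_ord (l x).
  by rewrite /=; repeat case: ifP; lia.
(* The defect of the face rule at [x]. Each color l x - s carried by [x] bounds r + s - 1, modulo d,
   by the jump minus 1. *)
pose r : 'I_n.+3 := (l (next_corner x) - l x - 1)%R.
suff r0 : r = 0%R.
  by apply/eqP; rewrite -subr_eq0 opprD addrA -/r r0.
have r_le s : 0 < s <= jump l x -> (r + (s%:R - 1))%R <= (jump l x).-1.
  move=> /andP[s_gt0 sx].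
  have s_lt : s < n.+3 by lia.
  have xs : colored l (l x - s%:R)%R x.
    rewrite /colored /level.
    have -> : (l x - 1 - (l x - s%:R) = s%:R - 1 :> 'I_n.+3)%R by ring.
    by rewrite val_subZ val_oneZ val_natZ // s_gt0; lia.
  have /andP[nc le] := colored_between xv xs.
  have := jump_level l (l x - s%:R + 1)%R (opp x); rewrite (negPf nc).
  rewrite -[finv cw (opp x)]/(next_corner x) {1}/level.
  have -> : (l (next_corner x) - 1 - (l x - s%:R + 1) = r + (s%:R - 1) :> 'I_n.+3)%R.
    by rewrite /r; ring.
  by lia.
clearbody r; have [r0|r_gt0] := posnP r; first exact: val_inj.
have := r_le 1; rewrite x_gt0 mulr1n subrr addr0 => /(_ erefl) r1.
(* If r is positive, this s lies between 1 and the jump and makes r + s - 1 equal to the jump. *)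
have := r_le (jump l x - r + 1).
rewrite val_addZ val_subZ val_oneZ val_natZ; last first.
  by have := ltn_ord (l x - l (finv cw x))%R; rewrite -/(jump l x); lia.
have := ltn_ord (l x - l (finv cw x))%R; rewrite -/(jump l x).
by repeat case: ifP; lia.
Qed.

Lemma next_label x : rface x != ext_face G -> l (next_corner x) = (l x + 1)%R.
Proof.
move=> xf; have [xI|] := boolP (inner_dart x); last first.
  rewrite negb_and xf /= negbK => /eqP/(ext_dart hG hu)[i []].
  rewrite /target oppK -/(target x) => xt xo.
  by rewrite (l_ext xo) (@l_ext (i + 1)%R) ?origin_next.
(* If [x] carries no color, [opp x] carries d - 2. The rule on its side transfers to [x], as the
   steps around the edge add up to 0 modulo d. *)
have [x0|/next_label_colored] := posnP (jump l x); last exact.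
have := colored_jump_opp xI; rewrite x0 add0n => ox.
have := @next_label_colored (opp x); rewrite inner_dart_opp ox => /(_ xI erefl).
rewrite next_opp => xp; move: x0 ox.
rewrite /jump xp -[finv cw (opp x)]/(next_corner x) => x0 ox.
have {}x0 : (l x - (l (opp x) + 1) = 0 :> 'I_n.+3)%R by apply: val_inj.
have {}ox : (l (opp x) - l (next_corner x) = - 1 - 1 :> 'I_n.+3)%R.
  by apply: ord_inj; rewrite ox val_subZ -[(- 1)%R]sub0r val_subZ val_oneZ /=; lia.
have -> : l x = (l (opp x) + 1)%R by apply/eqP; rewrite -subr_eq0 x0.
have -> : l (next_corner x) = (l (opp x) - (l (opp x) - l (next_corner x)))%R by ring.
by rewrite ox; ring.
Qed.

Lemma labelling_of_colored : clockwise_labelling u l.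
Proof.
split=> [x||v vi]; rewrite ?ordSE //.
  case: eqP => [/(ext_dart hG hu)[i [xo xt]]|/eqP/next_label -> //].
  by rewrite (l_ext xo) (@l_ext i) ?origin_next.
apply/eqP; rewrite -(@eqn_pmul2r n.+3) // card_descents (sum_jump l ord0).
rewrite eqn_pmul2r // -(decomposition_out ord0 vi); apply/eqP/eq_card => x.
by rewrite !inE l_colored.
Qed.

End FaceRule.

Lemma labelling_of_schnyder :
  exists2 l, clockwise_labelling u l & color_classes l = F.
Proof.
have /fin_all_exists[h hP] v : exists h : dart G -> 'I_n.+3, inner_vertex v ->
    forall x, origin x = v -> forall i, (x \in F i) = colored h i x.
  have [/local_labelling[h hP]|vi] := boolP (inner_vertex v); first by exists h.
  by exists (fun=> ord0).
(* At an external vertex [pick] finds its index, the color forced there. *)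
pose l := [ffun x => if inner_vertex (origin x) then h (origin x) x
                     else odflt ord0 [pick i | u i == origin x]].
have l_ext i x : origin x = u i -> l x = i.
  move=> xi; rewrite ffunE xi (inner_vertex_ext hG hu).
  by case: pickP => [j /eqP/(u_inj hu)|/(_ i)/eqP].
have l_colored i x : (x \in F i) = colored l i x.
  have [xv|xv] := boolP (inner_vertex (origin x)).
    rewrite (hP _ xv x erefl).
    by rewrite /colored /level /jump !ffunE origin_pred xv.
  rewrite (negPf (contraNN (@decomposition_origin i x) xv)); apply/esym/negbTE.
  have /negPn/(ext_vertexP hG hu)[j xj] := xv.
  by rewrite /colored /jump !(@l_ext j) ?origin_pred // subrr.
exists l; first exact: labelling_of_colored.
by apply/ffunP => i; apply/setP => x; rewrite in_color_classes l_colored.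
Qed.

End LabellingOfSchnyder.

(** * The bijections *)

Section Bijections.

Variables (n : nat) (G : plane_graph) (u : 'I_n.+3 -> vertex G).
Hypotheses (hG : d_angulation n.+3 G) (hu : external_contour u).

Definition orientation_of (l : {ffun dart G -> 'I_n.+3}) :
    {ffun {x : dart G | inner_dart x} -> 'I_(n.+3 - 2).+1} :=
  [ffun a => inord (jump l (val a))].

Lemma orientation_ofE l a : clockwise_labelling u l ->
  orientation_of l a = jump l (val a) :> nat.
Proof.
move=> hl; rewrite ffunE inordK // ltnS.
by apply: leq_trans (leq_addr _ _) (eq_leq (jump_opp hG hu hl (valP a))).
Qed.

Lemma sum_inner_dart v (F : dart G -> nat) : (forall x, ~~ inner_dart x -> F x = 0) ->
  \sum_(a : {x : dart G | inner_dart x} | origin (val a) == v) F (val a) =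
  \sum_(x | origin x == v) F x.
Proof.
move=> F0; rewrite [RHS](bigID (@inner_dart G)) /= [X in _ + X]big1 ?addn0; last first.
  by move=> x /andP[_ /F0].
rewrite (@reindex_omap _ _ _ _ _ val (fun x => insub x : option {x | inner_dart x})).
  by apply: eq_bigl => a /=; rewrite valK eqxx (valP a) !andbT.
by move=> x /andP[_ xi]; rewrite insubT.
Qed.

Lemma orientation_of_bij :
  set_bij (clockwise_labelling u) (@d_orientation n.+3 G) orientation_of.
Proof.
split=> [l hl|l l'|o [o_frac o_out]].
- split=> [a b ab|v]; first rewrite !orientation_ofE // ab.
    exact: (jump_opp hG hu hl (valP a)).
  rewrite /outdegree (eq_bigr (fun a => jump l (val a))) => [|a _]; last first.
    exact: orientation_ofE.
  rewrite (sum_inner_dart _ (jump_ninner hG hu hl)).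
  exact: (sum_jump_vertex hG hu hl).
- rewrite !classical_sets.in_setE => hl hl' /ffunP eqo.
  apply: (labelling_jump_inj hG hu hl hl') => x.
  have [xi|xi] := boolP (inner_dart x); last first.
    by rewrite (jump_ninner hG hu hl xi) (jump_ninner hG hu hl' xi).
  have := orientation_ofE (Sub x xi) hl; by rewrite eqo orientation_ofE.
(* The orientation is extended by 0 to external edges. *)
pose w x := if insub x is Some a then nat_of_ord (o a) else 0.
have wE a : w (val a) = o a by rewrite /w valK.
have w_ninner x : ~~ inner_dart x -> w x = 0 by move=> xi; rewrite /w insubN.
have w_opp x : inner_dart x -> w x + w (opp x) = n.+1.
  move=> xi; have oxi : inner_dart (opp x) by rewrite inner_dart_opp.
  by have := o_frac (Sub x xi) (Sub (opp x) oxi) erefl; rewrite -!wE.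
have [|l hl lw] := labelling_of_weight hG hu w_opp w_ninner.
  move=> v; rewrite -(o_out v) /outdegree -sum_inner_dart //.
  by apply: eq_bigr => a _; rewrite wE.
exists l => //; apply/ffunP => a; apply: ord_inj.
by rewrite orientation_ofE // lw wE.
Qed.

Lemma color_classes_bij : set_bij (clockwise_labelling u)
  (schnyder_decomposition u) (fun l => color_classes l).
Proof.
split=> [l|l l'|F hF].
- exact: schnyder_of_labelling.
- rewrite !classical_sets.in_setE => hl hl' /ffunP eqF.
  apply: (labelling_jump_inj hG hu hl hl') => x.
  rewrite -!card_colored; apply: eq_card => i.
  by rewrite !inE -!in_color_classes eqF.
have [l hl lF] := labelling_of_schnyder hG hu hF.
by exists l.
Qed.

End Bijections.

Theorem theorem3p1 (d : nat) (G : plane_graph) (u : 'I_d -> vertex G)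
    (hd : 3 <= d) (hG : d_angulation d G) (hu : external_contour u) :
  [/\ exists f : {ffun 'I_d -> {set dart G}} -> {ffun dart G -> 'I_d},
        set_bij (schnyder_decomposition u) (clockwise_labelling u) f,
      exists g : {ffun dart G -> 'I_d} ->
                 {ffun {x : dart G | inner_dart x} -> 'I_(d - 2).+1},
        set_bij (clockwise_labelling u) (@d_orientation d G) g
    & exists h : {ffun {x : dart G | inner_dart x} -> 'I_(d - 2).+1} ->
                 {ffun 'I_d -> {set dart G}},
        set_bij (@d_orientation d G) (schnyder_decomposition u) h].
Proof.
case: d u hd hG hu => [|[|[|n]]] // u _ hG hu.
have orient := orientation_of_bij hG hu; have classes := color_classes_bij hG hu.
split.
(* The inverse of the bijection from labellings to decompositions; the constant labelling is only a
   default value. *)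
- exists ('pinv_(fun=> [ffun=> ord0]) (clockwise_labelling u)
            (fun l => color_classes l)).
  exact: bijpinv_bij.
- by exists (@orientation_of n G).
exists ((fun l => color_classes l) \o
        'pinv_(fun=> [ffun=> ord0]) (clockwise_labelling u) (@orientation_of n G)).
by apply: set_bij_comp classes; exact: bijpinv_bij.
Qed.
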